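(* Let $k$ be a field of characteristic zero, and let $f,g\in k[x]$ be nonconstant. The following are equivalent. (i) The curve $C_{f,g}$ has a non-graph $k$-rational one-infinity component $C$ with $d_X(C)=2$. (ii) There exist $\alpha\in k^*$, $\beta,c\in k$, a nonzero polynomial $E\in k[U]$, and a nonconstant polynomial $G\in k[Z]$ such that $$g(Y)=G((Y-c)^2)\qquad\text{and}\qquad f(\alpha U+\beta)=G\bigl(U E(U)^2\bigr).$$ In this case a corresponding component is parametrized by $$X=\alpha t^2+\beta,\qquad Y=c+tE(t^2).$$ Consequently, if $g$ has no nontrivial affine involution $Y\mapsto 2c-Y$ (with $c\in k$) satisfying $g(2c-Y)=g(Y)$, then $C_{f,g}$ has no non-graph $k$-rational one-infinity component with $d_X=2$. In particular, if $\deg g$ is odd, no such component exists.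
   Context: $C_{f,g}=(f(X)-g(Y)=0)_{\mathrm{red}}\subset\mathbb A^2_k$. For a geometrically integral component $C$ of $C_{f,g}$, $C^\nu$ is its affine normalization and $\widetilde C$ its smooth projective normalization; $C$ is a $k$-rational one-infinity component if it is a geometrically integral component over $k$ with $\widetilde C\cong\mathbb P^1_k$ and $\widetilde C\setminus C^\nu$ consisting of exactly one geometric point. $d_X(C)=[k(C):k(X)]$ is the degree of the projection to the $X$-line. A graph component is one of the form $Y=h(X)$ with $h\in k[X]$, $f=g\circ h$; non-graph means not of this form. *)

(* Defs.v *)
From HB Require Import structures.
From mathcomp Require Import all_boot all_order all_algebra all_field.

Set Implicit Arguments.
Unset Strict Implicit.
Unset Printing Implicit Defensive.

Import GRing.Theory.
Local Open Scope ring_scope.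

(* k[X,Y] is {poly {poly k}}: the inner variable is X, the outer one is Y, so  *)
(* f(X) is f%:P and g(Y) is map_poly polyC g.                                  *)

Section PlaneCurves.

Variable k : fieldType.

Definition divides (P A : {poly {poly k}}) : Prop := exists Q, A = P * Q.

(* V(P) is a plane curve which is an integral scheme: P != 0 and the quotient  *)
(* k[X,Y]/(P) is an integral domain.                                           *)
Definition integral_curve (P : {poly {poly k}}) : Prop :=
  [/\ P != 0, ~ divides P 1
    & forall A B, divides P (A * B) -> divides P A \/ divides P B].

(* The irreducible components of (f(X) - g(Y) = 0)_red, with their reduced     *)
(* structure, are the integral curves V(P) contained in it.                    *)
Definition component (f g : {poly k}) (P : {poly {poly k}}) : Prop :=
  integral_curve P /\ divides P (f%:P - map_poly polyC g).

(* Equality of the ideals (P) and (Q). *)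
Definition same_curve (P Q : {poly {poly k}}) : Prop :=
  divides P Q /\ divides Q P.

Definition graph_component (f g : {poly k}) (P : {poly {poly k}}) : Prop :=
  exists h : {poly k}, f = g \Po h /\ same_curve P ('X - h%:P).

(* k(T); also the field k(X) below. *)
Definition ratfun := {fraction {poly k}}.

Definition ratfunC (c : k) : ratfun := FracField.tofrac c%:P.

Section Coordinates.

Variable K : fieldExtType ratfun.

Definition constC (c : k) : K := (ratfunC c)%:A.

Definition eval_at (y : K) (A : {poly {poly k}}) : K :=
  (map_poly (fun a : {poly k} => (FracField.tofrac a : ratfun)%:A : K) A).[y].

End Coordinates.

(* The function field k(C) = Frac(k[X,Y]/(P)) of C = V(P), for C dominating    *)
(* the X-line, presented as a finite extension of k(X) with a distinguished    *)
(* element Y. It is unique up to a unique isomorphism.                         *)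
Record function_field (P : {poly {poly k}}) := FunctionField {
  ff_field :> fieldExtType ratfun;
  ff_Y : ff_field;
  ff_ker : forall A, eval_at ff_Y A = 0 <-> divides P A;
  ff_frac : forall z : ff_field, exists A B,
    eval_at ff_Y B != 0 /\ z = eval_at ff_Y A / eval_at ff_Y B }.

Definition d_X (P : {poly {poly k}}) (F : function_field P) : nat :=
  \dim {: ff_field F}.

(* The smooth projective curve with function field k(C) is isomorphic to P^1_k *)
(* over k: smooth projective curves are given by their function fields, so     *)
(* this is a k-isomorphism from k(T) to k(C).                                  *)
Definition normalization_is_P1 (P : {poly {poly k}}) (F : function_field P) :=
  exists sigma : {rmorphism ratfun -> ff_field F},
    bijective sigma /\ (forall c, sigma (ratfunC c) = constC F c).

Section GeometricPoints.

Variables (kbar : fieldType) (iota : {rmorphism k -> kbar}).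

(* A kbar-point of the smooth projective curve with function field K is a      *)
(* point p together with a k-embedding in kbar of its residue field; as the    *)
(* local rings of the curve are the valuation rings of K over k, this is the   *)
(* same as a place K -> kbar + {oo} over k, where None stands for oo: the      *)
(* local ring is { z | phi z <> None }, its maximal ideal                      *)
(* { z | phi z = Some 0 }.                                                     *)
Definition geometric_point (K : fieldExtType ratfun) (phi : K -> option kbar) :=
  [/\ forall c, phi (constC K c) = Some (iota c),
      forall a b u v, phi a = Some u -> phi b = Some v ->
        phi (a + b) = Some (u + v) /\ phi (a * b) = Some (u * v)
    & forall a, phi a = None -> phi a^-1 = Some 0].

(* The affine normalization is the spectrum of the integral closure of k[C] in *)
(* k(C); its geometric points are those where this ring is regular.            *)
Definition on_affine_normalization (P : {poly {poly k}})
    (F : function_field P) (phi : ff_field F -> option kbar) : Prop :=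
  forall z : ff_field F, integralOver (eval_at (ff_Y F)) z -> phi z <> None.

Definition geometric_point_at_infinity (P : {poly {poly k}})
    (F : function_field P) (phi : ff_field F -> option kbar) : Prop :=
  geometric_point phi /\ ~ on_affine_normalization phi.

Definition one_geometric_point_at_infinity (P : {poly {poly k}})
    (F : function_field P) : Prop :=
  exists phi : ff_field F -> option kbar, geometric_point_at_infinity phi /\
    forall psi : ff_field F -> option kbar,
      geometric_point_at_infinity psi -> psi =1 phi.

End GeometricPoints.

(* The curve V(P) is parametrized by X = x(t), Y = y(t): it is the Zariski     *)
(* closure of the image, and t is a rational function of (x(t), y(t)).         *)
Definition subst (x y : {poly k}) (A : {poly {poly k}}) : {poly k} :=
  (map_poly (fun a : {poly k} => a \Po x) A).[y].

Definition parametrized_by (P : {poly {poly k}}) (x y : {poly k}) : Prop :=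
  (forall A, subst x y A = 0 <-> divides P A) /\
  (exists A B, subst x y B != 0 /\ subst x y A = 'X * subst x y B).

Definition square_decomposition (f g : {poly k})
    (alpha beta c : k) (E G : {poly k}) : Prop :=
  [/\ alpha != 0, E != 0, (1 < size G)%N,
      g = G \Po ('X - c%:P) ^+ 2
    & f \Po (alpha *: 'X + beta%:P) = G \Po ('X * E ^+ 2)].

End PlaneCurves.

Section OneInfinity.

Variables (k kbar : fieldType) (iota : {rmorphism k -> kbar}).

(* kbar is meant to be an algebraic closure of k. *)
Definition geometrically_integral (P : {poly {poly k}}) : Prop :=
  integral_curve (map_poly (map_poly iota) P).

Definition rational_one_infinity_component (f g : {poly k})
    (P : {poly {poly k}}) (F : function_field P) : Prop :=
  [/\ component f g P, geometrically_integral P,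
      normalization_is_P1 F & one_geometric_point_at_infinity iota F].

Definition nongraph_deg2_component (f g : {poly k})
    (P : {poly {poly k}}) (F : function_field P) : Prop :=
  [/\ rational_one_infinity_component f g F, ~ graph_component f g P
    & d_X F = 2].

Definition has_nongraph_deg2_component (f g : {poly k}) : Prop :=
  exists (P : {poly {poly k}}) (F : function_field P),
    nongraph_deg2_component f g F.

End OneInfinity.

(* Main.v *)
Require Import Defs.
From HB Require Import structures.
From mathcomp Require Import all_boot all_order all_algebra all_field.
From mathcomp Require Import ring zify.

(* Places of k(T) over k with values in kbar are the points of P^1(kbar), the  *)
(* place being determined by the value of T. If exactly one of them is a pole  *)
(* of X or Y, it is either T = oo, and then X and Y are polynomials in T, or   *)
(* T = a, where a is the only root of a denominator over k, hence a is in k    *)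
(* (characteristic 0), and 1/(T - a) is a generator in which X and Y are       *)
(* polynomials. As [k(T) : k(X)] = 2, X has degree 2, and X = alpha t^2 + beta *)
(* after completing the square. Then g(Y(t)) = f(X(t)) = g(Y(-t)); for g       *)
(* without subleading term this forces Y(-t) = +-Y(t) by comparing degrees,    *)
(* and Y(-t) = Y(t) is impossible because t is a rational function of X and Y. *)
(* So up to a translation of Y by c, Y is odd and g is even.                   *)
(* Conversely, (Y - c)^2 = U E(U)^2 with U = (X - beta)/alpha is the required  *)
(* component; its ideal is the kernel of the substitution, by splitting        *)
(* polynomials in t into even and odd parts. Its function field is realised as *)
(* k(t), an extension of k(X) by X |-> alpha t^2 + beta.                       *)

Set Implicit Arguments.
Unset Strict Implicit.
Import GRing.Theory.
Local Open Scope ring_scope.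

Local Notation "x %:F" := (FracField.tofrac x).

(** Both directions go through [parametrization]: a k-isomorphism from k(T) to the function field of
    the component under which the coordinates X and Y correspond to polynomials x(T) and y(T).

    From component to decomposition: the geometric points of the projective line are the places of
    k(T), determined by the value of T ([place_ext], [place_X_exists]). A single point at infinity
    means a single place where X or Y has a pole; a k-automorphism moves it to T = oo, so X and Y
    become polynomials ([polynomial_coordinates]). Degree 2 over k(X) forces x to be quadratic
    ([parametrizationX_size]), and completing the square makes x even. Then g(y(T)) = g(y(-T)), and
    rigidity of composition with a depressed polynomial ([comp_depressed_inj]) leaves only y(-T) - c
    = -(y(T) - c), whence the square decomposition ([square_decomposition_exists]).

    From decomposition to component: the candidate is [sqr_curve]. Its ideal is the kernel of the
    substitution of x(t), y(t) ([sqr_curve_divides]), so it is integral, over kbar as well; its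
    function field is k(T), seen as a quadratic extension of k(X) ([quadratic_extension]), and T =
    oo is the only point at infinity ([polynomial_parametrization_one_point]).

    The two corollaries only use that g is a polynomial in (Y - c)^2. *)

(** In every other term of the convolution one index exceeds its bound. The sizes are only bounded,
    so this also covers factors whose degree drops. *)
Lemma coefM_top (R : nzSemiRingType) (p q : {poly R}) m n :
  (size p <= m.+1)%N -> (size q <= n.+1)%N ->
  (p * q)`_(m + n) = p`_m * q`_n.
Proof.
move=> sp sq; have ltm : (m < (m + n).+1)%N by rewrite ltnS leq_addr.
rewrite coefM (bigD1 (Ordinal ltm)) //= addKn big1 ?addr0 // => i neq_im.
have [ltmi|leim] := ltnP m i.
  by rewrite nth_default ?mul0r // (leq_trans sp).
have ltim : (i < m)%N.
  rewrite ltn_neqAle leim andbT.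
  by apply: contraNneq neq_im => eqim; apply/eqP/val_inj.
by rewrite [q`__]nth_default ?mulr0 // (leq_trans sq) //; lia.
Qed.

(** * Right factors of an even composite in characteristic zero *)

Section CharZero.
Variable k : fieldType.
Hypothesis chark : [pchar k] =i pred0.

(* With z^n = 1, (q - z p) times the sum of the q^(n-1-i) (z p)^i, of degree   *)
(* (n-1) deg p, is a difference of terms of degree at most (n-2) deg p.        *)
Lemma comp_depressed_inj (g p q : {poly k}) :
  (1 < size g)%N -> g`_(size g).-2 = 0 -> (1 < size p)%N ->
  size q = size p -> g \Po p = g \Po q ->
  q = (lead_coef q / lead_coef p) *: p.
Proof.
move=> sg g0 sp sqp eqg.
have sq : (1 < size q)%N by rewrite sqp.
have lp0 : lead_coef p != 0 by rewrite lead_coef_eq0 -size_poly_gt0 ltnW.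
have lq0 : lead_coef q != 0 by rewrite lead_coef_eq0 -size_poly_gt0 ltnW.
have lg0 : lead_coef g != 0 by rewrite lead_coef_eq0 -size_poly_gt0 ltnW.
set z := _ / _; pose n := (size g).-1; pose d := (size p).-1.
have lzp : lead_coef (z *: p) = lead_coef q by rewrite lead_coefZ mulfVK.
have z0 : z != 0 by rewrite mulf_neq0 ?invr_eq0.
have szp : size (z *: p) = size p by rewrite size_scale.
have zn : z ^+ n = 1.
  have := congr1 lead_coef eqg; rewrite !lead_coef_comp //.
  move/(mulfI lg0) => eqn; rewrite /z expr_div_n -/n in eqn *.
  by rewrite -eqn divff // expf_neq0.
pose r := g - lead_coef g *: 'X^n.
have eg : g = lead_coef g *: 'X^n + r by rewrite addrC subrK.
have sr : (size r <= n.-1)%N.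
  apply/leq_sizeP => j; rewrite /r coefB coefZ coefXn.
  have [->|nj] := eqVneq j n; first by rewrite mulr1 subrr.
  rewrite mulr0 subr0 leq_eqVlt => /predU1P[<-|ltj]; first exact: g0.
  by rewrite nth_default //; move: nj ltj sg => /eqP; rewrite /n; case: (size g) => [|[|m]] /=; lia.
apply/eqP; rewrite -subr_eq0; apply: contraT => D0.
pose S := \sum_(i < n) q ^+ (n.-1 - i) * (z *: p) ^+ i.
have top : S`_(n.-1 * d) = lead_coef q ^+ n.-1 *+ n.
  rewrite coef_sum (eq_bigr (fun=> lead_coef q ^+ n.-1)).
    by rewrite sumr_const card_ord.
  move=> i _; have lei : (i <= n.-1)%N by have := ltn_ord i; lia.
  have -> : (n.-1 * d = (n.-1 - i) * d + i * d)%N by rewrite -mulnDl subnK.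
  have sz (a : {poly k}) j : size a = size p -> (size (a ^+ j)) = (j * d).+1.
    move=> sa; rewrite -[LHS]prednK ?size_poly_gt0 ?expf_neq0 -?size_poly_gt0 ?sa 1?ltnW //.
    by rewrite size_exp sa mulnC.
  rewrite coefM_top ?sz //.
  have lce (a : {poly k}) j : size a = size p -> (a ^+ j)`_(j * d) = lead_coef a ^+ j.
    by move=> sa; rewrite -lead_coef_exp lead_coefE sz.
  by rewrite !lce // lzp -exprD subnK.
have S0 : ((n.-1 * d).+1 <= size S)%N.
  rewrite leqNgt; apply/negP => /leq_sizeP/(_ _ (leqnn _)); rewrite top.
  move/eqP; rewrite -mulr_natl mulf_eq0 expf_eq0 (negPf lq0) andbF orbF.
  by move/pcharf0P: chark => ->; rewrite /n; lia.
(* Since z^n = 1, the product is q^n - p^n, and g(p) = g(q) trades the leading terms for the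
   remainders. *)
have ES : lead_coef g *: ((q - z *: p) * S) = (r \Po p) - (r \Po q).
  rewrite -subrXX exprZn zn scale1r.
  move: eqg; rewrite {1 2}eg !comp_polyD !comp_polyZ !comp_Xn_poly => eqg.
  rewrite scalerBr; apply/eqP; rewrite subr_eq addrAC eq_sym subr_eq eq_sym.
  by rewrite addrC -eqg addrC.
have sS : S != 0 by rewrite -size_poly_gt0 (leq_trans _ S0).
have : (size (lead_coef g *: ((q - z *: p) * S)) >= (n.-1 * d).+1)%N.
  rewrite size_scale // size_mul //; move: D0; rewrite -size_poly_gt0.
  by case: (size _) => // m _; rewrite addSn (leq_trans S0) ?leq_addl.
rewrite ES => /leq_trans/(_ (size_polyD _ _)); rewrite size_polyN.
have [r0|r0] := eqVneq r 0; first by rewrite r0 !comp_poly0 size_poly0.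
have := size_comp_poly r p; have := size_comp_poly r q; rewrite sqp -/d => eb ea.
have d0 : (0 < d)%N by rewrite /d; lia.
(* The missing subleading term gives deg r <= n - 2, so both composites have size at most (n - 1) d,
   one less than the left side needs. *)
have hn : ((size r).-1 * d + d <= n.-1 * d)%N.
  rewrite -mulSnr leq_mul2r prednK ?sr ?orbT //.
  by rewrite size_poly_gt0.
have le_pred m : (m <= m.-1 + d)%N by case: m => // m; rewrite /= -addn1 leq_add2l.
rewrite leq_max => /orP[] h; move: hn; rewrite leqNgt => /negP[].
  by rewrite -ea; apply: leq_trans h (le_pred _).
by rewrite -eb; apply: leq_trans h (le_pred _).
Qed.

(** The Tschirnhaus shift; the division by the degree needs characteristic zero. *)
Lemma exists_depressing_translation (g : {poly k}) : (1 < size g)%N ->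
  exists c, (g \Po ('X + c%:P))`_(size g).-2 = 0.
Proof.
move=> sg; have [n en] : exists n, size g = n.+2 by case: (size g) sg => [|[|n]] // _; exists n.
have n0 : n.+1%:R != 0 :> k by move/pcharf0P: chark => ->.
have l0 : lead_coef g != 0 by rewrite lead_coef_eq0 -size_poly_gt0 ltnW.
(* With deg g = n + 1, the coefficient of X^n in g(X + c) is g_n + (n + 1) c lead_coef g. *)
exists (- g`_n / (n.+1%:R * lead_coef g)); set c := _ / _; rewrite en /=.
have ec : 'X + c%:P = 'X - (- c)%:P by rewrite polyCN opprK.
have sX i : size (('X + c%:P) ^+ i) = i.+1 by rewrite ec size_exp_XsubC.
rewrite coef_comp_poly en big_ord_recr big_ord_recr big1 ?add0r /=; last first.
  by move=> i _; rewrite [X in _ * X]nth_default ?mulr0 // sX.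
have -> : (('X + c%:P) ^+ n)`_n = 1.
  have := lead_coefE (('X + c%:P) ^+ n).
  by rewrite sX /= => <-; rewrite ec lead_coef_exp lead_coefXsubC expr1n.
have -> : (('X + c%:P) ^+ n.+1)`_n = c *+ n.+1.
  have -> : ('X + c%:P) ^+ n.+1 = \prod_(a <- nseq n.+1 (- c)) ('X - a%:P).
    by rewrite big_nseq iter_mulr_1 ec.
  have := @coefPn_prod_XsubC k (nseq n.+1 (- c)); rewrite size_nseq => -> //.
  by rewrite big_nseq iter_addr_0 mulNrn opprK.
have -> : g`_n.+1 = lead_coef g by rewrite lead_coefE en.
rewrite /c -[_ *+ n.+1]mulr_natr; move: (n.+1%:R) n0 => N n0.
by field; rewrite l0 n0.
Qed.

Lemma comp_sqrX_oppX (p : {poly k}) : (p \Po 'X^2) \Po (- 'X) = p \Po 'X^2.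
Proof. by rewrite -comp_polyA comp_Xn_poly sqrrN. Qed.

Lemma comp_oppX_even (g : {poly k}) : g \Po (- 'X) = g ->
  g = even_poly g \Po 'X^2.
Proof.
move=> eg; rewrite -[LHS]poly_even_odd.
suff -> : odd_poly g = 0 by rewrite comp_poly0 mul0r addr0.
move: eg; rewrite -{1 2}(poly_even_odd g) comp_polyD comp_polyM !comp_sqrX_oppX.
rewrite comp_polyX mulrN => /addrI/eqP.
rewrite eq_sym -subr_eq0 opprK -mulr2n -scaler_nat scaler_eq0.
move/pcharf0P: chark => ->.
by rewrite orFb mulf_eq0 polyX_eq0 orbF comp_poly_eq0 ?size_polyXn // => /eqP.
Qed.

(** After depressing g to [g1] and shifting y to w = y - c, the composite g1(w) is even, so w(X) and
    w(-X) are two right factors of equal degree and must be proportional. *)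
Lemma square_decomposition_exists (f g y : {poly k}) (alpha beta : k) :
    (1 < size g)%N -> alpha != 0 -> odd_poly y != 0 ->
    f \Po (alpha *: 'X^2 + beta%:P) = g \Po y ->
  exists c G, square_decomposition f g alpha beta c (odd_poly y) G /\
              y = c%:P + 'X * (odd_poly y \Po 'X^2).
Proof.
move=> sg alpha0 E0 efg; have [c hc] := exists_depressing_translation sg.
pose g1 := g \Po ('X + c%:P); pose w := y - c%:P.
have tr : (('X + c%:P) \Po ('X - c%:P) = 'X :> {poly k})
          /\ (('X - c%:P) \Po ('X + c%:P) = 'X :> {poly k}).
  by split; rewrite ?comp_polyB ?comp_polyD comp_polyX comp_polyC ?addrK ?subrK.
have eg : g = g1 \Po ('X - c%:P) by rewrite /g1 -comp_polyA tr.1 comp_polyXr.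
have sg1 : size g1 = size g.
  by rewrite /g1 size_comp_poly2 // -[c%:P]opprK -polyCN size_XsubC.
have odd_w : odd_poly w = odd_poly y.
  by apply/polyP => i; rewrite !coef_odd_poly coefB coefC subr0.
have ew : even_poly w \Po 'X^2 + (odd_poly w \Po 'X^2) * 'X = w.
  exact: poly_even_odd.
have sX2 : (1 < size ('X^2 : {poly k}))%N by rewrite size_polyXn.
have O0 : (odd_poly w \Po 'X^2) * 'X != 0.
  by rewrite mulf_neq0 ?polyX_eq0 // comp_poly_eq0 // odd_w.
pose wm := w \Po - 'X.
have ewm : wm = even_poly w \Po 'X^2 - (odd_poly w \Po 'X^2) * 'X.
  by rewrite /wm -{1}ew comp_polyD comp_polyM !comp_sqrX_oppX comp_polyX mulrN.
have sN : size (- 'X : {poly k}) = 2%N by rewrite size_polyN size_polyX.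
have swm : size wm = size w by rewrite /wm size_comp_poly2.
have sw : (1 < size w)%N.
  rewrite ltnNge; apply/negP => /size1_polyC ew1.
  move: O0; rewrite odd_w -odd_w ew1.
  suff -> : odd_poly (w`_0)%:P = 0 by rewrite comp_poly0 mul0r eqxx.
  by apply/polyP => i; rewrite coef_odd_poly coefC coef0.
have g1w : g1 \Po w = f \Po (alpha *: 'X^2 + beta%:P).
  by rewrite efg /g1 -comp_polyA comp_polyD comp_polyX comp_polyC subrK.
have g1wm : g1 \Po w = g1 \Po wm.
  rewrite /wm comp_polyA g1w -comp_polyA comp_polyD comp_polyZ comp_polyC.
  by rewrite comp_Xn_poly sqrrN.
have lwm : lead_coef wm = lead_coef w * (-1) ^+ (size w).-1.
  by rewrite lead_coef_comp ?sN // lead_coefN lead_coefX.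
have lw0 : lead_coef w != 0 by rewrite lead_coef_eq0 -size_poly_gt0 ltnW.
have hc' : g1`_(size g1).-2 = 0 by rewrite sg1.
have sg1' : (1 < size g1)%N by rewrite sg1.
have two0 : 2%:R != 0 :> k by move/pcharf0P: chark => ->.
have := comp_depressed_inj sg1' hc' sw swm g1wm.
(* The ratio of leading coefficients of w(-X) and w(X) is (-1)^deg w. The sign + would kill the odd
   part, so w is odd. *)
rewrite lwm mulrAC divff // mul1r -signr_odd.
case: (odd _); last first.
  rewrite expr0 scale1r ewm => e; have := etrans e (esym ew); move=> /addrI/eqP.
  rewrite eq_sym -subr_eq0 opprK -mulr2n -scaler_nat scaler_eq0 (negPf two0) orFb.
  by rewrite (negPf O0).
rewrite expr1 scaleN1r ewm => e; have := etrans e (congr1 -%R (esym ew)).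
rewrite opprD => /addIr/eqP.
rewrite -subr_eq0 opprK -mulr2n -scaler_nat scaler_eq0 (negPf two0) orFb => /eqP eA.
have ew2 : w = 'X * (odd_poly y \Po 'X^2) by rewrite -ew eA add0r mulrC odd_w.
have wmE : wm = - w by rewrite ewm -[in RHS]ew eA sub0r add0r.
(* g1(-w) = g1(w), and composition with the nonconstant w can be cancelled. *)
have g1_even : g1 \Po - 'X = g1.
  apply/eqP; rewrite -subr_eq0 -(comp_poly_eq0 _ sw) comp_polyB -comp_polyA.
  have -> : - 'X \Po w = - w by rewrite raddfN /= comp_polyX.
  by rewrite -wmE -g1wm subrr.
pose G := even_poly g1; have eG : g1 = G \Po 'X^2 := comp_oppX_even g1_even.
exists c, G; split; last by rewrite -ew2 addrC subrK.
split=> //.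
- rewrite ltnNge; apply/negP => /size1_polyC G1.
  by move: sg1'; rewrite eG G1 comp_polyC size_polyC; case: (_ != 0).
- by rewrite {1}eg eG -comp_polyA comp_Xn_poly.
(* The identity for f is checked after substituting X^2, which is injective; there it reads g1(w) =
   G(w^2). *)
apply/eqP; rewrite -subr_eq0 -(comp_poly_eq0 _ sX2) comp_polyB subr_eq0 -!comp_polyA.
rewrite comp_polyD comp_polyZ comp_polyX comp_polyC -g1w eG -comp_polyA comp_Xn_poly ew2.
by rewrite comp_polyM comp_polyX rmorphXn /= exprMn.
Qed.
End CharZero.

(** * Fields of fractions and rational functions *)

Lemma frac_repr (R : idomainType) (x : {fraction R}) :
  x = (\n_(repr x))%:F / (\d_(repr x))%:F.
Proof.
have d0 : (\d_(repr x))%:F != 0 by rewrite tofrac_eq0 denom_ratioP.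
apply: (canRL (mulfK d0)); rewrite -{1}[x]reprK; unlock FracField.tofrac.
rewrite -[LHS]FracField.pi_mul /FracField.mulf /=.
rewrite !numden_Ratio ?oner_neq0 // mulr1.
apply/eqmodP; rewrite /= FracField.equivfE !numden_Ratio ?oner_neq0 ?mulf_neq0 ?denom_ratioP //.
by rewrite mulr1 mulrC.
Qed.

Lemma fracP (R : idomainType) (x : {fraction R}) :
  exists n d : R, d != 0 /\ x = n%:F / d%:F.
Proof. by exists \n_(repr x), \d_(repr x); rewrite denom_ratioP -frac_repr. Qed.

(** The universal property of the fraction field. The map is computed on the chosen representative,
    and [FE] shows that any other representative gives the same value. *)
Lemma frac_lift (R : idomainType) (L : fieldType) (h : {rmorphism R -> L}) :
    (forall a, h a = 0 -> a = 0) ->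
  exists theta : {rmorphism {fraction R} -> L}, forall a, theta a%:F = h a.
Proof.
move=> h_inj; have h0 a : a != 0 -> h a != 0 by apply: contra_neq; apply: h_inj.
pose F (x : {fraction R}) := h \n_(repr x) / h \d_(repr x).
have FE n d : d != 0 -> F (n%:F / d%:F) = h n / h d.
  move=> d0; set x := _ / _; have d'0 := denom_ratioP (repr x).
  have /eqP := frac_repr x; rewrite {1}/x eqr_div ?tofrac_eq0 //.
  rewrite -!tofracM tofrac_eq => /eqP e.
  by apply/eqP; rewrite eqr_div ?h0 // -!rmorphM /= -e.
have Fzmod : zmod_morphism F.
  move=> x y; have [n [d [d0 ->]]] := fracP x; have [m [e [e0 ->]]] := fracP y.
  rewrite -mulNr addf_div ?tofrac_eq0 // -tofracN -!tofracM -tofracD !FE ?mulf_neq0 //.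
  by rewrite rmorphD !rmorphM rmorphN /= -addf_div ?h0 // mulNr.
have Fmonoid : monoid_morphism F.
  split; first by rewrite -[1]divr1 -tofrac1 FE ?oner_neq0 // rmorph1 divr1.
  move=> x y; have [n [d [d0 ->]]] := fracP x; have [m [e [e0 ->]]] := fracP y.
  by rewrite mulf_div -!tofracM !FE ?mulf_neq0 // !rmorphM /= mulf_div.
pose M1 := GRing.isZmodMorphism.Build _ _ F Fzmod.
pose M2 := GRing.isMonoidMorphism.Build _ _ F Fmonoid.
pose theta : {rmorphism {fraction R} -> L} := HB.pack F M1 M2.
exists theta => a; rewrite -[a%:F]divr1 -tofrac1.
by rewrite -[RHS]divr1 -(rmorph1 h) -FE ?oner_neq0.
Qed.

HB.instance Definition _ (k : fieldType) :=
  GRing.RMorphism.copy (@ratfunC k) (@FracField.tofrac {poly k} \o polyC).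

HB.instance Definition _ (k : fieldType) (K : fieldExtType (ratfun k)) :=
  GRing.RMorphism.copy (@constC k K) (in_alg K \o @ratfunC k).

Section RationalFunctions.
Variable k : fieldType.
Local Notation T := (('X : {poly k})%:F).

Lemma tofrac_poly (p : {poly k}) : p%:F = (map_poly (@ratfunC k) p).[T].
Proof.
elim/poly_ind: p => [|p c IH]; first by rewrite tofrac0 rmorph0 horner0.
by rewrite tofracD tofracM IH rmorphD rmorphM /= map_polyX map_polyC hornerMXaddC.
Qed.

Lemma rmorph_tofrac (L : fieldType) (theta : {rmorphism ratfun k -> L})
    (j : {rmorphism k -> L}) (p : {poly k}) :
  (forall c, theta (ratfunC c) = j c) ->
  theta p%:F = (map_poly j p).[theta T].
Proof.
move=> thetaC; rewrite tofrac_poly -horner_map -map_poly_comp.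
by congr _.[_]; apply: eq_map_poly => c /=; rewrite thetaC.
Qed.

Lemma ratfun_rmorph_ext (L : fieldType) (f g : {rmorphism ratfun k -> L}) :
  f T = g T -> (forall c, f (ratfunC c) = g (ratfunC c)) -> f =1 g.
Proof.
move=> eT eC x; have [n [d [_ ->]]] := fracP x; rewrite !fmorph_div.
have e p : f p%:F = g p%:F.
  rewrite (rmorph_tofrac (j := g \o @ratfunC k)) //.
  by rewrite [RHS](rmorph_tofrac (j := g \o @ratfunC k)) // eT.
by rewrite !e.
Qed.

Lemma ratfun_lift (L : fieldType) (j : {rmorphism k -> L}) (z : L) :
  ~ algebraicOver j z ->
  exists theta : {rmorphism ratfun k -> L},
    theta T = z /\ forall c, theta (ratfunC c) = j c.
Proof.
move=> zNalg; have jz : commr_rmorph j z by move=> c; apply: mulrC.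
have [|theta thetaE] := @frac_lift _ L (horner_morph jz).
  move=> p p0; apply/eqP/negPn/negP => pn0.
  by apply: zNalg; exists p => //; apply/rootP.
exists theta; split; first by rewrite thetaE /= horner_morphX.
by move=> c; rewrite thetaE /= horner_morphC.
Qed.

Lemma ratfunX_neqC c : T != ratfunC c.
Proof.
rewrite tofrac_eq; apply/negP => /eqP/(congr1 (fun p : {poly k} => size p)).
by rewrite size_polyX size_polyC; case: (_ == _).
Qed.

Lemma ratfunX_transcendental (l : fieldType) (j : {rmorphism l -> k}) :
  ~ algebraicOver (@ratfunC k \o j) T.
Proof.
case=> p p0 /rootP; rewrite map_poly_comp -tofrac_poly.
by move/eqP; rewrite tofrac_eq0 map_poly_eq0 (negPf p0).
Qed.

(** Transcendence is over the smaller field l: with u algebraic over l it allows an embedding of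
    l(T) into k(T) sending T to u + 1/T. *)
Lemma ratfunX_inv_transcendental (l : fieldType) (j : {rmorphism l -> k}) (u : k) :
  algebraicOver j u -> ~ algebraicOver (@ratfunC k \o j) (ratfunC u + T^-1).
Proof.
case=> q q0 /rootP qu uT; apply: (@ratfunX_transcendental l j).
have algu : algebraicOver (@ratfunC k \o j) (ratfunC u).
  exists q => //; apply/rootP; rewrite map_poly_comp.
  by rewrite -[X in _.[X]]/(ratfunC u) horner_map qu rmorph0.
rewrite -[T]invrK; apply: algebraic_inv.
by have := algebraic_sub uT algu; rewrite addrC addKr.
Qed.
End RationalFunctions.

(** * Places *)

(** The conditions of [geometric_point] for arbitrary fields, so that points of a curve and places
    of k(T) can be pulled back to one another by [place_comp]. *)
Definition place (k l L : fieldType) (j : k -> L) (i : k -> l)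
    (phi : L -> option l) :=
  [/\ forall c, phi (j c) = Some (i c),
      forall a b u v, phi a = Some u -> phi b = Some v ->
        phi (a + b) = Some (u + v) /\ phi (a * b) = Some (u * v)
    & forall a, phi a = None -> phi a^-1 = Some 0].

Lemma place_comp (k k' l L L' : fieldType) (j : k -> L) (i : k -> l)
    (j' : k' -> L') (h : k' -> k) (theta : {rmorphism L' -> L}) phi :
  place j i phi -> (forall c, theta (j' c) = j (h c)) ->
  place j' (i \o h) (phi \o theta).
Proof.
case=> phiC phiDM phiV thetaC; split=> [c|a b u v|a] /=.
- by rewrite thetaC phiC.
- by rewrite rmorphD rmorphM; apply: phiDM.
by rewrite fmorphV; apply: phiV.
Qed.

Section Places.
Variables (k l L : fieldType) (j : {rmorphism k -> L}) (i : {rmorphism k -> l}).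
Variable phi : L -> option l.
Hypothesis phiP : place j i phi.

Let phiC c : phi (j c) = Some (i c). Proof. by case: phiP. Qed.
Let phiD a b u v : phi a = Some u -> phi b = Some v -> phi (a + b) = Some (u + v).
Proof. by case: phiP => _ phiDM _ pa pb; case: (phiDM _ _ _ _ pa pb). Qed.
Let phiM a b u v : phi a = Some u -> phi b = Some v -> phi (a * b) = Some (u * v).
Proof. by case: phiP => _ phiDM _ pa pb; case: (phiDM _ _ _ _ pa pb). Qed.
Let phiV a : phi a = None -> phi a^-1 = Some 0. Proof. by case: phiP => _ _; apply. Qed.
Let phi0 : phi 0 = Some 0. Proof. by rewrite -(rmorph0 j) phiC rmorph0. Qed.
Let phi1 : phi 1 = Some 1. Proof. by rewrite -(rmorph1 j) phiC rmorph1. Qed.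

Lemma place_horner z u (p : {poly k}) :
  phi z = Some u -> phi (map_poly j p).[z] = Some (map_poly i p).[u].
Proof.
move=> zu; elim/poly_ind: p => [|p c IH]; first by rewrite !rmorph0 !horner0.
rewrite !rmorphD !rmorphM /= !map_polyX !map_polyC !hornerMXaddC.
by apply: phiD; [apply: phiM | apply: phiC].
Qed.

Lemma place_inv a u : phi a = Some u -> u != 0 -> phi a^-1 = Some u^-1.
Proof.
move=> au u0; have a0 : a != 0.
  by apply: contraNneq u0 => a0; move: au; rewrite a0 phi0 => -[<-].
case e : (phi a^-1) => [v|].
  have := phiM au e; rewrite divff // phi1 => -[euv].
  by congr Some; apply: (mulfI u0); rewrite divff.
by move: (phiV e); rewrite invrK au => -[u0']; rewrite u0' eqxx in u0.
Qed.

Lemma place_div a b u v : phi a = Some u -> phi b = Some v -> v != 0 ->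
  phi (a / b) = Some (u / v).
Proof. by move=> au bv v0; apply: phiM => //; apply: place_inv. Qed.

Lemma place_div_pole a b u : phi a = Some u -> u != 0 -> b != 0 ->
  phi b = Some 0 -> phi (a / b) = None.
Proof.
move=> au u0 b0 b00; case e: (phi _) => [w|] //.
by move: (phiM e b00); rewrite divfK // au mulr0 => -[u0']; rewrite u0' eqxx in u0.
Qed.

(** Valuation rings are integrally closed: if z had a pole, w = 1/z would have value 0, and the
    monic equation divided by z^n would write 1 as a sum of elements of value 0. *)
Lemma place_integral (A : nzRingType) (h : {rmorphism A -> L}) z :
  (forall a, phi (h a) <> None) -> integralOver h z -> phi z <> None.
Proof.
move=> hfin [p pmon pz] zNone; have wz := phiV zNone; set w := z^-1 in wz.
have z0 : z != 0 by apply/eqP => z0; move: zNone; rewrite z0 phi0.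
have w_pow m : phi (w ^+ m.+1) = Some 0.
  elim: m => [|m IH]; first by rewrite expr1.
  by rewrite exprS -(mul0r 0); apply: phiM.
have p0 : size p != 0%N by rewrite size_poly_eq0 monic_neq0.
pose n := (size p).-1.
have : phi (- \sum_(m < n) h p`_m * w ^+ (n - m)) = Some 0.
  rewrite -mulN1r -[in RHS](mulr0 (i (-1))); apply: phiM; first by rewrite -phiC rmorphN1.
  elim/big_rec: _ => // m x _ IH; rewrite -[in RHS](addr0 0); apply: phiD => //.
  case e: (phi (h p`_m)) => [v|]; last by case: (hfin p`_m).
  rewrite -[in RHS](mulr0 v); apply: phiM => //.
  by have := ltn_ord m; rewrite -subn_gt0; case: (_ - _)%N.
suff -> : - \sum_(m < n) h p`_m * w ^+ (n - m) = 1.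
  by rewrite phi1 => -[/eqP]; rewrite oner_eq0.
have e : z ^+ n + \sum_(m < n) h p`_m * z ^+ m = 0.
  move/rootP: pz; rewrite (@horner_coef_wide _ (size p)); last exact: size_poly.
  have -> : size p = n.+1 by rewrite /n prednK ?lt0n.
  rewrite big_ord_recr /= coef_map /= /n -/(lead_coef p) (monicP pmon) rmorph1 mul1r addrC.
  by move=> pz0; rewrite -[RHS]pz0; congr (_ + _); apply: eq_bigr => m _; rewrite coef_map.
have := congr1 ( *%R^~ (w ^+ n)) e.
rewrite mul0r mulrDl -exprMn divff // expr1n => /eqP.
rewrite addr_eq0 => /eqP ->; congr (- _); rewrite mulr_suml; apply: eq_bigr => m _.
have -> : w ^+ n = w ^+ m * w ^+ (n - m) by rewrite -exprD subnKC // ltnW.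
by rewrite -mulrA; congr (_ * _); rewrite mulrA -exprMn divff // expr1n mul1r.
Qed.
End Places.

Section PlaceAtInfinity.
Variable L : fieldType.
Implicit Types (p q : {poly L}) (x y : ratfun L).

(* The value at oo of p/q, read off the coefficients of index deg q. *)
Definition place_infty x : option L :=
  let p := \n_(repr x) in let q := \d_(repr x) in
  if (size p <= size q)%N then Some (p`_(size q).-1 / lead_coef q) else None.

(** Independence of the representative: p q' = p' q equates the degree differences and, by
    [coefM_top], the ratios of the coefficients at the degrees of the denominators. *)
Lemma place_inftyE p q : q != 0 ->
  place_infty (p%:F / q%:F) =
    if (size p <= size q)%N then Some (p`_(size q).-1 / lead_coef q) else None.
Proof.
move=> q0; set x := _ / _; have q'0 := denom_ratioP (repr x).
have /eqP := frac_repr x; rewrite {1}/x eqr_div ?tofrac_eq0 // /place_infty.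
move: (\n_(repr x)) (\d_(repr x)) q'0 => p' q' q'0.
rewrite -!tofracM tofrac_eq => /eqP e.
have [p0|p0] := eqVneq p 0.
  move: e => /esym/eqP; rewrite p0 mul0r mulf_eq0 (negPf q0) orbF => /eqP ->.
  by rewrite size_poly0 !leq0n !coef0 !mul0r.
have p'0 : p' != 0.
  by apply: contra_eq_neq e => ->; rewrite mul0r mulf_neq0.
have es : (size p + size q' = size p' + size q)%N.
  have := congr1 (fun r : {poly L} => size r) e; rewrite /= !size_mul //.
  move: p0 q0 p'0 q'0; rewrite -!size_poly_gt0.
  move: (size p) (size q) (size p') (size q') => a b c d; lia.
have -> : (size p' <= size q')%N = (size p <= size q)%N.
  by move: es; move: (size p) (size q) (size p') (size q') => a b c d es; lia.
case: ifP => // sp; congr Some; apply/eqP; rewrite eqr_div ?lead_coef_eq0 //.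
have sp' : (size p' <= size q')%N.
  by move: es sp; move: (size p) (size q) (size p') (size q') => a b c d; lia.
have pred m n : (m <= n -> m <= n.-1.+1)%N by lia.
rewrite !lead_coefE -!coefM_top ?leqSpred ?pred //.
by rewrite -e addnC.
Qed.

Lemma place_infty_place : place (@ratfunC L) id place_infty.
Proof.
have F1 : 1%:F = 1 :> ratfun L by exact: tofrac1.
split=> [c|x y u v|x].
- rewrite -[ratfunC c]divr1 -F1 place_inftyE ?oner_neq0 // size_poly1 size_polyC_leq1.
  by rewrite lead_coef1 divr1 coefC.
- have [n [d [d0 ->]]] := fracP x; have [m [e [e0 ->]]] := fracP y.
  have pred a b : (a <= b -> a <= b.-1.+1)%N by lia.
  have d1 : (0 < size d)%N by rewrite size_poly_gt0.
  have e1 : (0 < size e)%N by rewrite size_poly_gt0.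
  rewrite addf_div ?tofrac_eq0 // mulf_div -!tofracM -tofracD !place_inftyE ?mulf_neq0 //.
  case: ifP => // sn [<-]; case: ifP => // sm [<-].
  have sM (a b : {poly L}) : (size a <= size d)%N -> (size b <= size e)%N ->
    (size (a * b)%R <= size (d * e)%R)%N.
    move=> ha hb; apply: leq_trans (size_polyMleq _ _) _.
    by rewrite size_mul //; lia.
  have -> : (size (d * e)).-1 = ((size d).-1 + (size e).-1)%N.
    by rewrite size_mul //; lia.
  have cM (a b : {poly L}) : (size a <= size d)%N -> (size b <= size e)%N ->
     (a * b)`_((size d).-1 + (size e).-1) = a`_(size d).-1 * b`_(size e).-1.
    by move=> ha hb; rewrite coefM_top // pred.
  rewrite sM // cM // lead_coefM; split; last by rewrite mulf_div.
  rewrite ifT; last first.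
    by rewrite (leq_trans (size_polyD _ _)) // geq_max sM //= [m * d]mulrC sM.
  rewrite coefD cM // [m * d]mulrC cM // -!lead_coefE.
  by congr Some; rewrite [RHS]addf_div ?lead_coef_eq0 // [_ * lead_coef d]mulrC.
have [n [d [d0 ->]]] := fracP x; rewrite invf_div place_inftyE //.
case: ifP => // /negbT; rewrite -ltnNge => sd _.
have n0 : n != 0 by rewrite -size_poly_gt0 (leq_ltn_trans _ sd).
rewrite place_inftyE // (ltnW sd); congr Some.
by rewrite nth_default ?mul0r // -ltnS prednK ?size_poly_gt0.
Qed.
End PlaceAtInfinity.

(** * Places of k(T) as points of the projective line *)

Section PlacesOfP1.
Variables (k l : fieldType) (i : {rmorphism k -> l}).
Local Notation T := (('X : {poly k})%:F).

Lemma frac_coprime (x : ratfun k) :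
  exists p q : {poly k}, [/\ coprimep p q, q != 0 & x = p%:F / q%:F].
Proof.
have [n [d [d0 ->]]] := fracP x; exists (n %/ gcdp n d), (d %/ gcdp n d).
have nd0 : (n != 0) || (d != 0) by rewrite d0 orbT.
have g0 : gcdp n d != 0 by rewrite gcdp_eq0 negb_and.
have ed : d = d %/ gcdp n d * gcdp n d by rewrite divpK ?dvdp_gcdr.
have dg0 : d %/ gcdp n d != 0 by apply: contraNneq d0 => e; rewrite ed e mul0r.
split=> //; first exact: coprimep_div_gcd.
apply/eqP; rewrite eqr_div ?tofrac_eq0 // -!tofracM tofrac_eq.
have en : n = n %/ gcdp n d * gcdp n d by rewrite divpK ?dvdp_gcdl.
by rewrite {1}en -mulrA [gcdp _ _ * _]mulrC -ed.
Qed.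

(** Every place is a pullback of the place at infinity of l(T), along T |-> T for the value oo and T
    |-> u + 1/T for a finite value u. *)
Lemma place_X_exists (u : option l) : (forall v, algebraicOver i v) ->
  exists phi, place (@ratfunC k) i phi /\ phi T = u.
Proof.
move=> algl; pose j : {rmorphism k -> ratfun l} := @ratfunC l \o i.
suff [z [zNalg zu]] : exists z : ratfun l, ~ algebraicOver j z /\ place_infty z = u.
  have [theta [thetaT thetaC]] := ratfun_lift zNalg.
  exists (@place_infty l \o theta); split; last by rewrite /= thetaT.
  exact: (place_comp (place_infty_place l)).
have F1 : 1%:F = 1 :> ratfun l by exact: tofrac1.
case: u => [u|]; last first.
  exists ('X%:F); split; first exact: ratfunX_transcendental.
  by rewrite -['X%:F]divr1 -F1 place_inftyE ?oner_neq0 // size_polyX size_poly1.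
exists (ratfunC u + ('X%:F)^-1); split; first exact/ratfunX_inv_transcendental.
have [pC pDM pV] := place_infty_place l.
have e : place_infty ('X%:F)^-1 = Some (0 : l).
  apply: pV; rewrite -['X%:F]divr1 -F1 place_inftyE ?oner_neq0 //.
  by rewrite size_polyX size_poly1.
by have [-> _] := pDM _ _ _ _ (pC u) e; rewrite addr0.
Qed.

(** In a reduced fraction p/q the polynomials p and q have no common root u, so the place either
    evaluates the quotient or has a pole. *)
Lemma place_finite_ext phi psi u :
  place (@ratfunC k) i phi -> place (@ratfunC k) i psi ->
  phi T = Some u -> psi T = Some u -> phi =1 psi.
Proof.
move=> phiP psiP phiT psiT x; have [p [q [pq q0 ->]]] := frac_coprime x.
have ev (chi : ratfun k -> option l) (r : {poly k}) :
    place (@ratfunC k) i chi -> chi T = Some u ->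
    chi r%:F = Some (map_poly i r).[u].
  by move=> chiP chiT; rewrite tofrac_poly; apply: place_horner.
have [q_root|q_root] := eqVneq (map_poly i q).[u] 0; last first.
  have quot chi : place (@ratfunC k) i chi -> chi T = Some u ->
      chi (p%:F / q%:F) = Some ((map_poly i p).[u] / (map_poly i q).[u]).
    by move=> chiP chiT; apply: (place_div chiP) => //; apply: ev.
  by rewrite !quot.
have p_root : (map_poly i p).[u] != 0.
  by rewrite -(coprimep_map i) coprimep_sym in pq; apply: coprimep_root pq _; apply/rootP.
have pole chi : place (@ratfunC k) i chi -> chi T = Some u -> chi (p%:F / q%:F) = None.
  move=> chiP chiT; apply: (place_div_pole chiP (ev _ p chiP chiT)) => //.
    by rewrite tofrac_eq0.
  by rewrite ev // q_root.
by rewrite !pole.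
Qed.

Definition k_automorphism (theta : {rmorphism ratfun k -> ratfun k}) :=
  bijective theta /\ forall c, theta (ratfunC c) = ratfunC c.

(** Endomorphisms over k are determined by the image of T, so T |-> z and T |-> z' are mutually
    inverse as soon as both composites fix T. *)
Lemma k_automorphism_of_inverse (z z' : ratfun k) :
    ~ algebraicOver (@ratfunC k) z -> ~ algebraicOver (@ratfunC k) z' ->
    (forall theta : {rmorphism ratfun k -> ratfun k},
      (forall c, theta (ratfunC c) = ratfunC c) ->
      (theta T = z -> theta z' = T) /\ (theta T = z' -> theta z = T)) ->
  exists2 theta, k_automorphism theta & theta T = z.
Proof.
move=> zNalg z'Nalg inv; have [theta [thetaT thetaC]] := ratfun_lift zNalg.
have [theta' [theta'T theta'C]] := ratfun_lift z'Nalg.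
exists theta => //; split=> //; exists theta' => x.
  rewrite -[LHS]/((theta' \o theta) x) -[RHS]/(idfun x).
  apply: ratfun_rmorph_ext => [|c] /=; last by rewrite thetaC theta'C.
  by rewrite thetaT; apply: (inv theta' theta'C).2.
rewrite -[LHS]/((theta \o theta') x) -[RHS]/(idfun x).
apply: ratfun_rmorph_ext => [|c] /=; last by rewrite theta'C thetaC.
by rewrite theta'T; apply: (inv theta thetaC).1.
Qed.

Lemma ratfunX_transcendental_base : ~ algebraicOver (@ratfunC k) T.
Proof. exact: (@ratfunX_transcendental k k idfun). Qed.

Lemma algebraic_ratfunC c : algebraicOver (@ratfunC k) (ratfunC c).
Proof. exact: algebraic_id. Qed.

Lemma ratfunX_translate_transcendental c : ~ algebraicOver (@ratfunC k) (T - ratfunC c).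
Proof.
move=> alg; apply: ratfunX_transcendental_base.
by rewrite -[T](subrK (ratfunC c)); apply: algebraic_add (algebraic_ratfunC c).
Qed.

Lemma k_automorphism_translate (a : k) :
  exists2 theta, k_automorphism theta & theta T = T - ratfunC a.
Proof.
apply: (@k_automorphism_of_inverse _ (T + ratfunC a)).
- exact: ratfunX_translate_transcendental.
- by rewrite -[ratfunC a]opprK -rmorphN; apply: ratfunX_translate_transcendental.
by move=> theta thetaC; split=> e; rewrite !(rmorphD, rmorphN) /= e thetaC ?addrK ?subrK.
Qed.

Lemma k_automorphism_invert (a : k) :
  exists2 theta, k_automorphism theta & theta T = ratfunC a + T^-1.
Proof.
apply: (@k_automorphism_of_inverse _ (T - ratfunC a)^-1).
- have alga : algebraicOver (idfun : {rmorphism k -> k}) a by exact: algebraic_id.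
  exact: (ratfunX_inv_transcendental alga).
- move/algebraic_inv; rewrite invrK; exact: ratfunX_translate_transcendental.
move=> theta thetaC; split=> e.
  by rewrite fmorphV rmorphB /= e thetaC [ratfunC a + _]addrC addrK invrK.
by rewrite rmorphD fmorphV /= e thetaC invrK addrC subrK.
Qed.

(** A common pole at T becomes the common value 0 under T |-> 1/T, which reduces to
    [place_finite_ext]. *)
Lemma place_ext phi psi :
  place (@ratfunC k) i phi -> place (@ratfunC k) i psi ->
  phi T = psi T -> phi =1 psi.
Proof.
case e: (psi T) => [u|] phiP psiP phiT; first exact: place_finite_ext phiP psiP phiT e.
have [theta [[theta' _ theta'K] thetaC] thetaT] := k_automorphism_invert 0.
rewrite rmorph0 add0r in thetaT.
have at0 chi : place (@ratfunC k) i chi -> chi T = None ->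
    place (@ratfunC k) i (chi \o theta) /\ (chi \o theta) T = Some 0.
  move=> chiP chiT; split; last by rewrite /= thetaT; case: chiP => _ _; apply.
  exact: (@place_comp k k l _ _ _ i _ idfun theta chi chiP).
have [phiP' phiT'] := at0 _ phiP phiT; have [psiP' psiT'] := at0 _ psiP e.
by move=> x; rewrite -[x]theta'K; apply: (place_finite_ext phiP' psiP' phiT' psiT').
Qed.

End PlacesOfP1.

Lemma rmorph_inverse (L L' : fieldType) (s : {rmorphism L -> L'}) :
  bijective s -> exists t : {rmorphism L' -> L}, cancel s t /\ cancel t s.
Proof.
case=> t sK tK.
have t_zmod : zmod_morphism t.
  by move=> x y; apply: (can_inj sK); rewrite rmorphB !tK.
have t_monoid : monoid_morphism t.
  split; first by rewrite -(rmorph1 s) sK.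
  by move=> x y; apply: (can_inj sK); rewrite rmorphM !tK.
pose M1 := GRing.isZmodMorphism.Build _ _ t t_zmod.
pose M2 := GRing.isMonoidMorphism.Build _ _ t t_monoid.
by exists (HB.pack_for {rmorphism L' -> L} t M1 M2).
Qed.

(* T is integral over k[p(T)]. *)
Lemma place_poly_pole (k l : fieldType) (i : {rmorphism k -> l}) phi (p : {poly k}) :
  place (@ratfunC k) i phi -> phi ('X%:F) = None -> (1 < size p)%N ->
  phi p%:F = None.
Proof.
move=> phiP phiT sp; case e: (phi p%:F) => [u|] //; exfalso.
have p0 : p != 0 by rewrite -size_poly_gt0 ltnW.
have comm_p : commr_rmorph (@ratfunC k) p%:F by move=> c; apply: mulrC.
apply: (place_integral phiP (h := horner_morph comm_p)) phiT => [a|].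
  by rewrite /= /horner_morph (place_horner phiP _ e).
pose q := (lead_coef p)^-1 *: p.
have qmon : q \is monic by rewrite monicE lead_coefZ mulVf ?lead_coef_eq0.
have szq : size q = size p by rewrite size_scale ?invr_eq0 ?lead_coef_eq0.
have szq' : size (map_poly polyC q) = size p.
  by rewrite size_map_poly_id0 ?szq // (monicP qmon) polyC_eq0 oner_eq0.
(* The equation of T: q(Z) - W / lead_coef p, monic in Z, with the coefficient variable W evaluated
   at p(T). *)
exists (map_poly polyC q - ((lead_coef p)^-1 *: 'X)%:P).
  rewrite monicE lead_coefDl ?size_polyN ?size_polyC ?szq'.
    by rewrite lead_coef_map_eq ?(monicP qmon) ?polyC_eq0 ?oner_eq0.
  by rewrite (leq_ltn_trans _ sp) // leq_b1.
apply/rootP; rewrite rmorphB /= map_polyC hornerD hornerN hornerC -map_poly_comp.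
rewrite (eq_map_poly (g := @ratfunC k)) => [|c /=]; last exact: horner_morphC.
rewrite -tofrac_poly /q -!mul_polyC tofracM /= /horner_morph.
by rewrite rmorphM /= map_polyC map_polyX hornerM hornerC hornerX subrr.
Qed.

(** * Moving the unique pole to infinity *)

Section PolynomialCoordinates.
Variables (k : fieldType) (kbar : closedFieldType) (iota : {rmorphism k -> kbar}).
Hypothesis chark : [pchar k] =i pred0.
Hypothesis halg : forall z : kbar, algebraicOver iota z.
Local Notation T := (('X : {poly k})%:F).
Local Notation kplace := (place (@ratfunC k) iota).

Lemma finite_pole (p q : {poly k}) a :
    coprimep p q -> q != 0 -> root (map_poly iota q) a ->
  exists phi, [/\ kplace phi, phi T = Some a & phi (p%:F / q%:F) = None].
Proof.
move=> pq q0 /rootP qa; have [phi [phiP phiT]] := place_X_exists (Some a) halg.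
have ev (r : {poly k}) : phi r%:F = Some (map_poly iota r).[a].
  by rewrite tofrac_poly; apply: place_horner.
exists phi; split=> //; apply: (place_div_pole phiP (ev p)).
- by rewrite -(coprimep_map iota) coprimep_sym in pq; apply: coprimep_root pq _; apply/rootP.
- by rewrite tofrac_eq0.
by rewrite ev qa.
Qed.

Lemma closed_root (q : {poly k}) : size q != 1%N -> exists a, root (map_poly iota q) a.
Proof. by move=> sq; apply/closed_rootP; rewrite size_map_poly. Qed.

Lemma constant_denominator (p q : {poly k}) : size q = 1%N ->
  exists r : {poly k}, p%:F / q%:F = r%:F.
Proof.
move=> sq; have /eqP/size_poly1P[c c0 ->] := sq; exists (c^-1 *: p).
apply: (canLR (mulfK _)); first by rewrite tofrac_eq0 polyC_eq0.
by rewrite -tofracM mulrC mul_polyC scalerA divff // scale1r.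
Qed.

(** A nonconstant reduced denominator has a root in kbar, which gives a pole of x at a finite value
    of T. *)
Lemma regular_ratfun (x : ratfun k) :
  (forall phi, kplace phi -> phi x = None -> phi T = None) -> exists p, x = p%:F.
Proof.
move=> x_reg; have [p [q [pq q0 ex]]] := frac_coprime x.
have [sq|sq] := eqVneq (size q) 1%N; first by rewrite ex; apply: constant_denominator.
have [a qa] := closed_root sq; have [phi [phiP phiT phix]] := finite_pole pq q0 qa.
by rewrite -ex in phix; have := x_reg _ phiP phix; rewrite phiT.
Qed.

(* The root is read off the two leading coefficients of q = lc (X - a)^m.      *)
Lemma unique_root_rational (q : {poly k}) a : q != 0 -> root (map_poly iota q) a ->
  (forall b, root (map_poly iota q) b -> b = a) -> exists a0, a = iota a0.
Proof.
move=> q0 qa q_uniq; have [s es] := closed_field_poly_normal (map_poly iota q).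
have lq0 : iota (lead_coef q) != 0 by rewrite fmorph_eq0 lead_coef_eq0.
rewrite lead_coef_map in es.
have s_nseq : s = nseq (size s) a.
  apply/all_pred1P/allP => b bs; apply/eqP/q_uniq.
  by rewrite es rootZ // root_prod_XsubC.
have s0 : size s != 0%N.
  apply: contraTneq qa => /eqP; rewrite size_eq0 => /eqP s0.
  by rewrite es s0 big_nil rootZ // rootC oner_eq0.
have := congr1 (fun r : {poly kbar} => r`_(size s).-1) es.
have sum_s : \sum_(b <- s) b = a *+ size s by rewrite {1}s_nseq big_nseq iter_addr_0.
rewrite coef_map coefZ coefPn_prod_XsubC // sum_s /= => e.
have n0 : (size s)%:R != 0 :> kbar.
  rewrite -(rmorph_nat iota) fmorph_eq0; move/pcharf0P: chark => ->; exact: s0.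
exists (- q`_(size s).-1 / (lead_coef q * (size s)%:R)).
rewrite fmorph_div rmorphN rmorphM /= rmorph_nat e mulrN opprK -[a *+ _]mulr_natr.
by rewrite mulrCA mulfK // mulf_neq0.
Qed.

(** If the single pole is not T = oo, it is a k-rational value a0, and T |-> a0 + 1/T moves it
    there. *)
Lemma polynomial_coordinates (x y : ratfun k) :
    (forall c, x <> ratfunC c) ->
    (forall phi psi, kplace phi -> kplace psi ->
      phi x = None \/ phi y = None -> psi x = None \/ psi y = None -> phi =1 psi) ->
  exists2 theta : {rmorphism ratfun k -> ratfun k}, k_automorphism theta
    & exists p q : {poly k}, theta x = p%:F /\ theta y = q%:F.
Proof.
move=> x_nonconst pole_uniq.
have [oo [ooP ooT]] := place_X_exists None halg.
have [oo_pole|oo_nopole] := boolP ((oo x == None) || (oo y == None)).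
  have oo_pole' : oo x = None \/ oo y = None.
    by case/orP: oo_pole => /eqP; [left | right].
  exists idfun; first by split=> //; exists id.
  have [|p ep] := @regular_ratfun x.
    by move=> phi phiP phix; rewrite (pole_uniq _ _ phiP ooP (or_introl phix) oo_pole').
  have [|q eq] := @regular_ratfun y.
    by move=> phi phiP phiy; rewrite (pole_uniq _ _ phiP ooP (or_intror phiy) oo_pole').
  by exists p, q.
have [p [q [pq q0 ex]]] := frac_coprime x.
(* Otherwise x would be a nonconstant polynomial, with a pole at oo. *)
have sq : size q != 1%N.
  apply/eqP => /(constant_denominator p)[r er]; rewrite er in ex.
  have [sr|sr] := leqP (size r) 1.
    by apply: (x_nonconst r`_0); rewrite ex (size1_polyC sr) coefC.
  by move: oo_nopole; rewrite ex (place_poly_pole ooP ooT sr) eqxx.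
have pole_at a : root (map_poly iota q) a ->
    exists phi, [/\ kplace phi, phi T = Some a & phi x = None].
  by move/(finite_pole pq q0); rewrite ex.
have [a qa] := closed_root sq; have [phi [phiP phiT phix]] := pole_at a qa.
have [|a0 ea] := unique_root_rational q0 qa.
  move=> b /pole_at[psi [psiP psiT psix]].
  have := pole_uniq _ _ phiP psiP (or_introl phix) (or_introl psix) T.
  by rewrite phiT psiT => -[].
have [theta theta_auto thetaT] := k_automorphism_invert a0.
exists theta => //; have [_ thetaC] := theta_auto.
(* Pulled back along [theta], such a [psi] is the unique pole, so a0 + 1/T has value a under [psi].
   Then 1/T has value 0, which excludes a finite value of T. *)
have infinite psi : kplace psi -> psi (theta x) = None \/ psi (theta y) = None ->
    psi T = None.
  move=> psiP pole; case psiT: (psi T) => [u|] //; exfalso.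
  have psiP' : kplace (psi \o theta).
    exact: (@place_comp k k kbar _ _ _ iota _ idfun theta psi psiP).
  have := pole_uniq _ _ phiP psiP' (or_introl phix) pole T.
  rewrite phiT /= thetaT => /esym psiaT.
  have [psiC psiDM _] := psiP.
  have [psiTV _] := psiDM _ _ _ _ psiaT (psiC (- a0)).
  move: psiTV; rewrite rmorphN /= addrC addKr rmorphN /= -ea subrr => psiTV.
  have [_] := psiDM _ _ _ _ psiT psiTV.
  rewrite mulr0 divff ?tofrac_eq0 ?polyX_eq0 // -(rmorph1 (@ratfunC k)) psiC rmorph1.
  by move=> [/eqP]; rewrite oner_eq0.
have [|r er] := @regular_ratfun (theta x).
  by move=> psi psiP psix; apply: infinite => //; left.
have [|s es] := @regular_ratfun (theta y).
  by move=> psi psiP psiy; apply: infinite => //; right.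
by exists r, s.
Qed.
End PolynomialCoordinates.

(** * Parametrizations *)

Section Substitution.
Variable k : fieldType.
Implicit Types (x y z p : {poly k}) (A B : {poly {poly k}}).

(** The two summands have disjoint supports: even and odd exponents. *)
Lemma comp_evenD_odd_eq0 (a b : {poly k}) :
  (a \Po 'X^2) + (b \Po 'X^2) * 'X = 0 -> a = 0 /\ b = 0.
Proof.
move=> ab0; split; apply/polyP => i; rewrite coef0.
  have := congr1 (fun p : {poly k} => p`_i.*2) ab0.
  rewrite coefD coef0 coefMX !coef_comp_poly_Xn // dvdn2 odd_double -muln2 mulnK //=.
  case: i => [|i]; first by rewrite addr0.
  by rewrite dvdn2 mulSn /= oddM andbF addr0.
have := congr1 (fun p : {poly k} => p`_i.*2.+1) ab0.
rewrite coefD coef0 coefMX !coef_comp_poly_Xn // !dvdn2 /= odd_double /= add0r.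
by rewrite -muln2 mulnK.
Qed.

Lemma substE x y A : subst x y A = (map_poly (comp_poly x) A).[y].
Proof. by []. Qed.

Lemma substD x y : {morph subst x y : A B / A + B}.
Proof. by move=> A B; rewrite !substE rmorphD hornerD. Qed.

Lemma substB x y : {morph subst x y : A B / A - B}.
Proof. by move=> A B; rewrite !substE rmorphB hornerD hornerN. Qed.

Lemma substM x y : {morph subst x y : A B / A * B}.
Proof. by move=> A B; rewrite !substE rmorphM hornerM. Qed.

Lemma substC x y p : subst x y p%:P = p \Po x.
Proof. by rewrite substE map_polyC hornerC. Qed.

Lemma substX x y : subst x y 'X = y.
Proof. by rewrite substE map_polyX hornerX. Qed.

Lemma subst_map_polyC x y p : subst x y (map_poly polyC p) = p \Po y.
Proof.
rewrite substE -map_poly_comp; congr _.[_]; apply: eq_map_poly => c /=.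
by rewrite comp_polyC.
Qed.

Lemma subst_comp x y z A : subst x y A \Po z = subst (x \Po z) (y \Po z) A.
Proof.
rewrite !substE -[LHS]horner_map -map_poly_comp; congr _.[_].
by apply: eq_map_poly => p /=; rewrite comp_polyA.
Qed.

Lemma eval_atE (K : fieldExtType (ratfun k)) (v : K) A :
  eval_at v A = (map_poly (in_alg K \o @FracField.tofrac {poly k}) A).[v].
Proof. by []. Qed.

Lemma eval_atC (K : fieldExtType (ratfun k)) (v : K) p : eval_at v p%:P = (p%:F)%:A.
Proof. by rewrite eval_atE map_polyC hornerC. Qed.

Lemma eval_atX (K : fieldExtType (ratfun k)) (v : K) : eval_at v 'X = v.
Proof. by rewrite eval_atE map_polyX hornerX. Qed.

HB.instance Definition _ (K : fieldExtType (ratfun k)) (v : K) :=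
  GRing.RMorphism.copy (@eval_at k K v)
    (horner_eval v \o map_poly (in_alg K \o @FracField.tofrac {poly k})).

Lemma eval_at_rmorph (K : fieldExtType (ratfun k))
    (s : {rmorphism ratfun k -> K}) x y (v : K) A :
    (forall c, s (ratfunC c) = constC K c) ->
    s x%:F = ('X%:F)%:A -> s y%:F = v ->
  eval_at v A = s (subst x y A)%:F.
Proof.
move=> sC sx <-; rewrite substE /eval_at -[(_).[y]%:F]horner_map -horner_map.
rewrite -!map_poly_comp; congr _.[_]; apply: eq_map_poly => p /=.
rewrite -[LHS]/(in_alg K p%:F) (rmorph_tofrac (j := constC K)) //.
rewrite -[_ \Po _]/((map_poly polyC p).[x]) -2!horner_map -2!map_poly_comp /= sx.
by congr _.[_]; apply: eq_map_poly => c /=; rewrite -sC.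
Qed.
End Substitution.

(** * Parametrizations of the function field and the degree of X *)

Section FunctionField.
Variables (k : fieldType) (P : {poly {poly k}}) (F : function_field P).
Local Notation XF := (('X%:F)%:A : ff_field F).

Definition parametrization (s : {rmorphism ratfun k -> ff_field F}) (x y : {poly k}) :=
  [/\ bijective s, forall c, s (ratfunC c) = constC F c, s x%:F = XF & s y%:F = ff_Y F].

Lemma parametrization_eval s x y A : parametrization s x y ->
  eval_at (ff_Y F) A = s (subst x y A)%:F.
Proof. by case=> _ sC sx sy; apply: eval_at_rmorph. Qed.

Lemma parametrization_auto s theta x y x' y' :
    parametrization s x y -> k_automorphism theta ->
    theta x'%:F = x%:F -> theta y'%:F = y%:F ->
  parametrization (s \o theta) x' y'.
Proof.
case=> s_bij sC sx sy [theta_bij thetaC] ex ey.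
split; first exact: bij_comp.
- by move=> c; rewrite -[LHS]/(s (theta _)) thetaC.
- by rewrite -[LHS]/(s (theta _)) ex.
by rewrite -[LHS]/(s (theta _)) ey.
Qed.

Lemma parametrization_subst_eq0 s x y A : parametrization s x y ->
  subst x y A = 0 <-> divides P A.
Proof.
move=> s_param; rewrite -(ff_ker F) (parametrization_eval _ s_param); split=> [->|/eqP].
  by rewrite tofrac0 rmorph0.
by rewrite fmorph_eq0 tofrac_eq0 => /eqP.
Qed.

Lemma parametrization_parametrized s x y :
  parametrization s x y -> parametrized_by P x y.
Proof.
move=> s_param; split=> [A|]; first exact: parametrization_subst_eq0 s_param.
have [A [B [B0 e]]] := ff_frac (s 'X%:F); exists A, B.
rewrite !(parametrization_eval _ s_param) in B0 e.
move: B0; rewrite fmorph_eq0 tofrac_eq0 => B0; split=> //.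
apply/eqP; rewrite -tofrac_eq tofracM; apply/eqP.
apply: (canRL (divfK _)); first by rewrite tofrac_eq0.
by apply: (fmorph_inj s); rewrite fmorph_div.
Qed.

Lemma parametrizationX_size_gt1 s x y : parametrization s x y -> (1 < size x)%N.
Proof.
case=> _ sC sx _; rewrite ltnNge; apply/negP => /size1_polyC; move: (x`_0) => c ex.
have /(fmorph_inj (in_alg F))/eqP : in_alg F ('X%:F) = in_alg F (ratfunC c).
  by rewrite -[LHS]sx ex; apply: sC.
by rewrite (negPf (ratfunX_neqC c)).
Qed.

Section Dimension.
Variables (s : {rmorphism ratfun k -> ff_field F}) (x y : {poly k}).
Hypotheses (s_param : parametrization s x y) (dimF : d_X F = 2).

(** Transported to k(T), the scalar p(X) acts as multiplication by p(x(T)). *)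
Let scaleE (p : {poly k}) (z : ratfun k) : p%:F *: s z = s ((p \Po x)%:F * z).
Proof.
rewrite rmorphM /= -(substC x y) -(parametrization_eval _ s_param).
by rewrite eval_atC mulr_algl.
Qed.

(** If x is linear, T is a polynomial in X, so the field is the line spanned by 1 over k(X), against
    dimension 2. *)
Lemma parametrizationX_size_neq2 : size x != 2%N.
Proof.
apply/eqP => sx; have [[t sK tK] sC _ _] := s_param.
have : (\dim {: F} <= \dim <[1 : F]>)%N.
  apply: dimvS; apply/subvP => z _; rewrite -[z]tK.
  have [a [b [a0 ex]]] : exists a b, a != 0 /\ x = a *: 'X + b%:P.
    exists x`_1, x`_0; split.
      by rewrite -[1%N]/(2.-1) -sx -lead_coefE lead_coef_eq0 -size_poly_gt0 sx.
    apply/polyP => -[|[|i]]; rewrite coefD coefZ coefX coefC ?mulr0 ?mulr1 ?add0r ?addr0 //.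
    by rewrite nth_default ?sx.
  pose w : {poly k} := a^-1 *: ('X - b%:P).
  have wx : w \Po x = 'X.
    by rewrite /w comp_polyZ comp_polyB comp_polyX comp_polyC ex addrK scalerA mulVf ?scale1r.
  have im (p : {poly k}) : s p%:F = ((p \Po w)%:F)%:A.
    by rewrite -[1](rmorph1 s) scaleE -comp_polyA wx comp_polyXr mulr1.
  have [p [q [_ ->]]] := fracP (t z).
  rewrite fmorph_div !im -[_ / _]/(in_alg F _ / in_alg F _) -fmorph_div.
  exact: memvZ (memv_line _).
by rewrite dim_vline -/(d_X F) dimF oner_eq0.
Qed.

(* The three summands have degrees 0, 1, 2 modulo deg x >= 3, so they cannot   *)
(* cancel.                                                                     *)
Lemma comp_powers_free (a b c : {poly k}) : (3 < size x)%N ->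
  (a \Po x) + (b \Po x) * 'X + (c \Po x) * 'X^2 = 0 -> [/\ a = 0, b = 0 & c = 0].
Proof.
move=> sx e0; have sx1 : (1 < size x)%N by lia.
pose d := (size x).-1.
pose u i (p : {poly k}) := (p \Po x) * 'X^i.
have u0 i p : (u i p == 0) = (p == 0).
  by rewrite mulf_eq0 comp_poly_eq0 // expf_eq0 polyX_eq0 andbF orbF.
have su i p : p != 0 -> size (u i p) = ((size p).-1 * d + i).+1.
  move=> p0; have p1 : p \Po x != 0 by rewrite comp_poly_eq0.
  rewrite size_mulXn // -(prednK (n := size (_ \Po _))) ?size_poly_gt0 //.
  by rewrite size_comp_poly addnS addnC.
have neq i j p q : (i < 3)%N -> (j < 3)%N -> i != j ->
    size (u i p) = size (u j q) -> p = 0 /\ q = 0.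
  move=> i3 j3 ij e; have [p0|p0] := eqVneq p 0.
    split=> //; apply/eqP; rewrite -(u0 j) -size_poly_eq0 -e.
    by rewrite size_poly_eq0 u0 p0.
  have q0 : q != 0 by rewrite -(u0 j) -size_poly_eq0 -e size_poly_eq0 u0.
  move: e; rewrite !su // => -[] /(congr1 (modn^~ d)).
  have ltd m : (m < 3)%N -> (m < d)%N by rewrite /d; lia.
  by rewrite !modnMDl !modn_small ?ltd // => eij; rewrite eij eqxx in ij.
have e1 : u 0%N a + u 1%N b = - u 2%N c.
  by apply/eqP; rewrite -addr_eq0 /u expr0 mulr1 expr1 e0.
have := congr1 (fun p : {poly k} => size p) e1; rewrite /= size_polyN.
have [lt|lt|/(neq 0%N 1%N)[]// a0 b0] := ltngtP (size (u 0%N a)) (size (u 1%N b)).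
- rewrite addrC size_polyDl // => /(neq 1%N 2%N)[]// b0 _.
  by move: lt; rewrite (_ : u 1%N b = 0) ?size_poly0 //; apply/eqP; rewrite u0 b0.
- rewrite size_polyDl // => /(neq 0%N 2%N)[]// a0 _.
  by move: lt; rewrite (_ : u 0%N a = 0) ?size_poly0 //; apply/eqP; rewrite u0 a0.
move=> _; split=> //; apply/eqP; rewrite -(u0 2%N) -oppr_eq0 -e1.
by rewrite a0 b0 /u !comp_poly0 !mul0r addr0.
Qed.

(** If deg x >= 3, the elements 1, T, T^2 are free over k(X): clear denominators and apply
    [comp_powers_free]. *)
Lemma parametrizationX_size_le3 : (size x <= 3)%N.
Proof.
rewrite leqNgt; apply/negP => sx; pose v := [tuple 1; s 'X%:F; s ('X^2)%:F].
suff /eqP e : free v by have := dimvS (subvf <<v>>%VS); rewrite e -/(d_X F) dimF.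
apply/freeP => l l0.
have common : exists a b c d : {poly k}, [/\ d != 0, l 0 = a%:F / d%:F,
    l 1 = b%:F / d%:F & l 2%:R = c%:F / d%:F].
  have [a [d [d0 ->]]] := fracP (l 0); have [b [e [e0 ->]]] := fracP (l 1).
  have [c [f [f0 ->]]] := fracP (l 2%:R).
  have def0 : d * e * f != 0 by rewrite !mulf_neq0.
  exists (a * e * f), (b * d * f), (c * d * e), (d * e * f); split=> //;
    by apply/eqP; rewrite eqr_div ?tofrac_eq0 // -!tofracM tofrac_eq; apply/eqP; ring.
have [a [b [c [d [d0 ea eb ec]]]]] := common.
have [|a0 b0 c0] := @comp_powers_free a b c sx.
  apply/eqP; rewrite -tofrac_eq0 -(fmorph_eq0 s).
  have := congr1 (GRing.scale d%:F) l0; rewrite scaler0.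
  rewrite !big_ord_recl big_ord0 addr0 /= !scalerDr !scalerA.
  have -> : lift ord0 ord0 = 1 :> 'I_3 by apply: val_inj.
  have -> : lift ord0 (lift ord0 ord0) = 2%:R :> 'I_3 by apply: val_inj.
  rewrite ea eb ec ![d%:F * (_ / _)]mulrC !divfK ?tofrac_eq0 //.
  rewrite -(rmorph1 s) !scaleE mulr1 addrA => e.
  by rewrite !tofracD !(tofracM _ 'X) !(tofracM _ 'X^2) !rmorphD /= e.
move=> m; rewrite ?a0 ?b0 ?c0 tofrac0 mul0r in ea eb ec.
case: m => -[|[|[|//]]] m3.
- by rewrite -[RHS]ea; congr l; apply: val_inj.
- by rewrite -[RHS]eb; congr l; apply: val_inj.
by rewrite -[RHS]ec; congr l; apply: val_inj.
Qed.

Lemma parametrizationX_size : size x = 3%N.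
Proof.
have := parametrizationX_size_gt1 s_param.
by have := parametrizationX_size_le3; have := parametrizationX_size_neq2; lia.
Qed.
End Dimension.
End FunctionField.

(** * Points at infinity of a parametrized curve *)

Section Points.
Variables (k : fieldType) (kbar : closedFieldType) (iota : {rmorphism k -> kbar}).
Hypothesis halg : forall z : kbar, algebraicOver iota z.
Variables (P : {poly {poly k}}) (F : function_field P).

(** Where T is finite, so is all of k[T], which contains the coordinate ring; [place_integral]
    extends this to the integral closure. *)
Lemma finite_generator_on_affine_normalization (phi : ff_field F -> option kbar) s x y u :
    geometric_point iota phi -> parametrization s x y -> phi (s 'X%:F) = Some u ->
  on_affine_normalization phi.
Proof.
move=> phiP s_param phiT z zint.
have [_ sC _ _] := s_param.
have phisP : place (@ratfunC k) iota (phi \o s).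
  exact: (@place_comp k k kbar _ _ _ iota _ idfun s phi phiP).
have evE A : eval_at (ff_Y F) A = s (subst x y A)%:F := parametrization_eval A s_param.
have fin p : phi (s p%:F) <> None.
  have /= := place_horner phisP p phiT.
  by rewrite -tofrac_poly => ->.
pose h : {rmorphism {poly {poly k}} -> ff_field F} := @eval_at k (ff_field F) (ff_Y F).
apply: (@place_integral k kbar _ (@constC k F) iota phi phiP _ h z) => // A.
by rewrite -[h A]/(eval_at _ A) evE.
Qed.

Lemma pole_at_infinity (phi : ff_field F -> option kbar) A :
  phi (eval_at (ff_Y F) A) = None -> ~ on_affine_normalization phi.
Proof.
move=> phiA /(_ _ _ phiA); apply; exists ('X - A%:P); first exact: monicXsubC.
by apply/rootP; rewrite map_polyXsubC hornerXsubC subrr.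
Qed.

Lemma polynomial_parametrization_one_point (s : {rmorphism ratfun k -> ff_field F}) x y :
  parametrization s x y -> one_geometric_point_at_infinity iota F.
Proof.
move=> s_param; have [s_bij sC sx sy] := s_param; have [t [sK tK]] := rmorph_inverse s_bij.
have [oo [ooP ooT]] := place_X_exists None halg.
have tC c : t (constC F c) = ratfunC c by rewrite -sC sK.
have ootP : geometric_point iota (oo \o t).
  exact: (@place_comp k k kbar _ _ _ iota _ idfun t oo ooP).
exists (oo \o t); split.
  split=> //; apply: (@pole_at_infinity _ ('X%:P)); rewrite eval_atC /= -sx sK.
  by apply: place_poly_pole ooP ooT _; apply: parametrizationX_size_gt1 s_param.
move=> psi [psiP psi_inf] z.
have psiT : psi (s 'X%:F) = None.
  case e: (psi _) => [u|] //; case: psi_inf.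
  exact: finite_generator_on_affine_normalization psiP s_param e.
have psisP : place (@ratfunC k) iota (psi \o s).
  exact: (@place_comp k k kbar _ _ _ iota _ idfun s psi psiP).
have := place_ext psisP ooP _ (t z); rewrite /= tK; apply.
by rewrite psiT.
Qed.

Hypothesis chark : [pchar k] =i pred0.

(** A pole of X or Y is a point at infinity, since both are integral over the coordinate ring.
    Transported to k(T), uniqueness of that point is the hypothesis of [polynomial_coordinates]. *)
Lemma one_point_polynomial_parametrization :
    normalization_is_P1 F -> one_geometric_point_at_infinity iota F ->
  exists s x y, @parametrization k P F s x y.
Proof.
case=> s [s_bij sC] [oo [_ oo_uniq]]; have [t [sK tK]] := rmorph_inverse s_bij.
have tC c : t (constC F c) = ratfunC c by rewrite -sC sK.
have at_infinity phi : place (@ratfunC k) iota phi ->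
    phi (t ('X%:F)%:A) = None \/ phi (t (ff_Y F)) = None -> phi \o t =1 oo.
  move=> phiP pole; apply: oo_uniq; split.
    exact: (@place_comp k k kbar _ _ _ iota _ idfun t phi phiP).
  case: pole => pole.
    by apply: (@pole_at_infinity _ ('X%:P)); rewrite eval_atC.
  by apply: (@pole_at_infinity _ 'X); rewrite eval_atX.
have [c eX|phi psi phiP psiP phi_pole psi_pole z|theta theta_auto [x [y [ex ey]]]] :=
    @polynomial_coordinates k kbar iota chark halg (t ('X%:F)%:A) (t (ff_Y F)).
- have /(fmorph_inj (in_alg F))/eqP : in_alg F ('X%:F) = in_alg F (ratfunC c).
    by apply: (can_inj tK); rewrite /= eX; apply/esym/tC.
  by rewrite (negPf (ratfunX_neqC c)).
- rewrite -[z]sK -[LHS]/((phi \o t) _) -[RHS]/((psi \o t) _).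
  by rewrite at_infinity // at_infinity.
have [theta_bij thetaC] := theta_auto; have [theta' [thetaK theta'K]] := rmorph_inverse theta_bij.
exists (s \o theta'), x, y; split.
- apply: bij_comp => //; by exists theta.
- by move=> c; rewrite -[LHS]/(s (theta' _)) -thetaC thetaK.
- by rewrite -[LHS]/(s (theta' _)) -ex thetaK tK.
by rewrite -[LHS]/(s (theta' _)) -ey thetaK tK.
Qed.

End Points.

(** * Components of degree 2 and square decompositions *)

Section ComponentToDecomposition.
Variables (k : fieldType) (kbar : closedFieldType) (iota : {rmorphism k -> kbar}).
Hypothesis chark : [pchar k] =i pred0.
Hypothesis halg : forall z : kbar, algebraicOver iota z.
Variables f g : {poly k}.
Hypothesis size_g : (1 < size g)%N.

Lemma complete_square (x : {poly k}) : size x = 3%N ->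
  exists a r b, a != 0 /\ x \Po ('X - r%:P) = a *: 'X^2 + b%:P.
Proof.
move=> sx; pose a := x`_2; pose b := x`_1.
have a0 : a != 0 by rewrite /a -[2%N]/(3.-1) -sx -lead_coefE lead_coef_eq0 -size_poly_gt0 sx.
have two0 : 2%:R != 0 :> k by move/pcharf0P: chark => ->.
pose r := b / (2%:R * a); exists a, r, (x`_0 - a * r ^+ 2); split=> //.
have eb : b = 2%:R * a * r by rewrite /r mulrC divfK // mulf_neq0.
have ex : x = a *: 'X^2 + b *: 'X + (x`_0)%:P.
  apply/polyP => i; rewrite !coefD !coefZ coefXn coefX coefC.
  case: i => [|[|[|i]]]; rewrite /= ?mulr0 ?mulr1 ?add0r ?addr0 //.
  by rewrite nth_default ?sx.
rewrite [in LHS]ex; move: (x`_0) (r) eb => x0 s ->.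
rewrite !comp_polyD !comp_polyZ comp_Xn_poly comp_polyX comp_polyC.
by rewrite -!mul_polyC !(polyCB, polyCM, polyC_exp) polyC_natr; ring.
Qed.

Lemma ratfun_translate (theta : {rmorphism ratfun k -> ratfun k}) r (p : {poly k}) :
    (forall c, theta (ratfunC c) = ratfunC c) -> theta ('X%:F) = 'X%:F + ratfunC r ->
  theta (p \Po ('X - r%:P))%:F = p%:F.
Proof.
move=> thetaC thetaT; rewrite (rmorph_tofrac (j := @ratfunC k)) // thetaT.
have -> : 'X%:F + ratfunC r = ('X + r%:P)%:F by rewrite tofracD.
rewrite map_poly_comp horner_map -[_.[_]]/((p \Po ('X - r%:P)) \Po ('X + r%:P)).
by rewrite -comp_polyA comp_polyB comp_polyX comp_polyC addrK comp_polyXr.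
Qed.

(** If y were even, T = A(x, y) / B(x, y) would be a quotient of even polynomials. *)
Lemma parametrized_odd_part_neq0 (P : {poly {poly k}}) a b y :
  parametrized_by P (a *: 'X^2 + b%:P) y -> odd_poly y != 0.
Proof.
move=> [_ [A [B [B0 e]]]]; apply/eqP => y_even.
have ey : y = even_poly y \Po 'X^2 by rewrite -{1}[y]poly_even_odd y_even comp_poly0 mul0r addr0.
have ex : a *: 'X^2 + b%:P = (a *: 'X + b%:P) \Po 'X^2.
  by rewrite comp_polyD comp_polyZ comp_polyX comp_polyC.
rewrite ex ey -!subst_comp in B0 e.
have [_ B'0] : - subst (a *: 'X + b%:P) (even_poly y) A = 0
    /\ subst (a *: 'X + b%:P) (even_poly y) B = 0.
  by apply: comp_evenD_odd_eq0; rewrite raddfN /= e addrC mulrC subrr.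
by rewrite B'0 comp_poly0 eqxx in B0.
Qed.

Lemma component_comp_eq (P : {poly {poly k}}) x y : component f g P ->
  (forall A, subst x y A = 0 <-> divides P A) -> f \Po x = g \Po y.
Proof.
move=> [_ Pfg] kerP; apply/eqP; rewrite -subr_eq0 -(substC x y) -(subst_map_polyC x).
by rewrite -substB; apply/eqP/kerP.
Qed.

Lemma nongraph_deg2_decomposition (P : {poly {poly k}}) (F : function_field P) :
    nongraph_deg2_component iota f g F ->
  exists (alpha beta c : k) (E G : {poly k}),
    square_decomposition f g alpha beta c E G /\
    parametrized_by P (alpha *: 'X^2 + beta%:P) (c%:P + 'X * (E \Po 'X^2)).
Proof.
move=> [[compP _ F_P1 F_one] _ dimF].
have [s [x [y s_param]]] := one_point_polynomial_parametrization halg chark F_P1 F_one.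
have [alpha [r [beta [alpha0 ex]]]] := complete_square (parametrizationX_size s_param dimF).
(* The automorphism T |-> T + r replaces (x(T), y(T)) by (x(T - r), y(T - r)), whose first
   coordinate has no linear term. *)
have [theta theta_auto thetaT] := k_automorphism_translate (- r).
have thetaT' : theta ('X%:F) = 'X%:F + ratfunC r by rewrite thetaT rmorphN /= opprK.
pose y' := y \Po ('X - r%:P).
have tr p := ratfun_translate p theta_auto.2 thetaT'.
have := parametrization_auto s_param theta_auto (tr x) (tr y); rewrite ex -/y' => s'_param.
have P_param := parametrization_parametrized s'_param.
have odd_y0 := parametrized_odd_part_neq0 P_param.
have fg : f \Po (alpha *: 'X^2 + beta%:P) = g \Po y'.
  exact: component_comp_eq compP P_param.1.
have [c [G [dec ey]]] := square_decomposition_exists chark size_g alpha0 odd_y0 fg.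
by exists alpha, beta, c, (odd_poly y'), G; rewrite -ey.
Qed.

End ComponentToDecomposition.

(* (Y - c)^2 = U E(U)^2, where U = (X - beta) / alpha. *)
Definition sqr_curve (k : fieldType) (alpha beta c : k) (E : {poly k}) : {poly {poly k}} :=
  ('X - c%:P%:P) ^+ 2 - (('X * E ^+ 2) \Po (alpha^-1 *: ('X - beta%:P)))%:P.

(** * The curve attached to a square decomposition *)

Section SqrCurve.
Variables (k : fieldType) (alpha beta c : k) (E : {poly k}).
Hypotheses (alpha0 : alpha != 0) (E0 : E != 0).
Local Notation P := (sqr_curve alpha beta c E).
Local Notation x := (alpha *: 'X^2 + beta%:P).
Local Notation y := (c%:P + 'X * (E \Po 'X^2)).

Lemma affine_comp_inv : (alpha^-1 *: ('X - beta%:P)) \Po x = 'X^2.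
Proof.
by rewrite comp_polyZ comp_polyB comp_polyX comp_polyC addrK scalerA mulVf // scale1r.
Qed.

Lemma size_sqr_curve : size P = 3%N.
Proof.
by rewrite size_polyDl ?size_exp_XsubC // size_polyN ltnS size_polyC ltnW // ltnS leq_b1.
Qed.

Lemma sqr_curve_monic : P \is monic.
Proof.
rewrite monicE lead_coefDl; first by rewrite lead_coef_exp lead_coefXsubC expr1n.
by rewrite size_exp_XsubC size_polyN ltnS size_polyC ltnW // ltnS leq_b1.
Qed.

Lemma subst_sqr_curve : subst x y P = 0.
Proof.
rewrite substB expr2 substM substB substX !substC comp_polyC -comp_polyA affine_comp_inv.
rewrite comp_polyM comp_polyX rmorphXn /= [c%:P + _]addrC addrK; ring.
Qed.

(** Division by the monic quadratic P leaves R1 Y + R0. After substitution its odd part is R1(x)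
    E(t^2) t, so R1 = 0, and then the even part gives R0 = 0. *)
Lemma sqr_curve_divides A : subst x y A = 0 <-> divides P A.
Proof.
split=> [A0|[Q ->]]; last by rewrite substM subst_sqr_curve mul0r.
have eA := Pdiv.RingMonic.rdivp_eq sqr_curve_monic A.
set Q := Pdiv.Ring.rdivp A P in eA; set R := Pdiv.Ring.rmodp A P in eA.
exists Q; suff R0 : R = 0 by rewrite {1}eA R0 addr0 mulrC.
have sR : (size R <= 2)%N.
  rewrite -ltnS -size_sqr_curve; apply: Pdiv.Ring.ltn_rmodpN0.
  by rewrite monic_neq0 // sqr_curve_monic.
have eR : R = (R`_1)%:P * 'X + (R`_0)%:P.
  apply/polyP => -[|[|i]]; rewrite coefD coefMX !coefC ?add0r ?addr0 //= nth_default //.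
  by rewrite (leq_trans sR).
have ex : x = (alpha *: 'X + beta%:P) \Po 'X^2.
  by rewrite comp_polyD comp_polyZ comp_polyX comp_polyC.
have sx : (1 < size (alpha *: 'X + beta%:P)%R)%N.
  by rewrite size_polyDl size_scale ?size_polyX // size_polyC ltnS leq_b1.
have := A0; rewrite eA substD substM subst_sqr_curve mulr0 add0r eR substD substM !substC substX.
move: (R`_1) (R`_0) => R1 R0 e; rewrite ex !comp_polyA in e.
have [] : (R1 \Po (alpha *: 'X + beta%:P)) * c%:P + (R0 \Po (alpha *: 'X + beta%:P)) = 0
       /\ (R1 \Po (alpha *: 'X + beta%:P)) * E = 0.
  apply: comp_evenD_odd_eq0; rewrite comp_polyD !comp_polyM comp_polyC -[RHS]e; ring.
move=> e0 /eqP; rewrite mulf_eq0 (negPf E0) orbF comp_poly_eq0 // => /eqP R10.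
move/eqP: e0; rewrite R10 comp_poly0 mul0r add0r comp_poly_eq0 // => /eqP ->.
by rewrite mul0r add0r.
Qed.

Lemma sqr_curve_integral : integral_curve P.
Proof.
split; first by rewrite monic_neq0 // sqr_curve_monic.
  move/sqr_curve_divides/eqP.
  by rewrite -[1]/(1%:P) substC comp_polyC oner_eq0.
move=> A B /sqr_curve_divides; rewrite substM => /eqP; rewrite mulf_eq0.
by case/orP => /eqP AB0; [left | right]; apply/sqr_curve_divides.
Qed.

(** P has degree 2 in Y and cannot divide Y - h(X). *)
Lemma sqr_curve_nongraph (f g : {poly k}) : ~ graph_component f g P.
Proof.
move=> [h [_ [[Q e] _]]]; have := congr1 (fun p : {poly {poly k}} => size p) e.
rewrite size_XsubC; have Q0 : Q != 0.
  by apply: contra_eq_neq e => ->; rewrite mulr0 polyXsubC_eq0.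
rewrite size_monicM // ?sqr_curve_monic // size_sqr_curve.
by move: Q0; rewrite -size_poly_gt0; move: (size Q) => n; lia.
Qed.

Lemma sqr_curve_component (f g G : {poly k}) :
  square_decomposition f g alpha beta c E G -> component f g P.
Proof.
move=> [_ _ _ eg ef]; split; first exact: sqr_curve_integral.
apply/sqr_curve_divides; rewrite substB substC subst_map_polyC.
have ex : x = (alpha *: 'X + beta%:P) \Po 'X^2.
  by rewrite comp_polyD comp_polyZ comp_polyX comp_polyC.
rewrite ex comp_polyA ef eg -!comp_polyA comp_polyM comp_polyX !rmorphXn /=.
by rewrite comp_polyB comp_polyX comp_polyC [c%:P + _]addrC addrK exprMn subrr.
Qed.

End SqrCurve.

Lemma map_sqr_curve (k l : fieldType) (i : {rmorphism k -> l}) alpha beta c (E : {poly k}) :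
  map_poly (map_poly i) (sqr_curve alpha beta c E) =
  sqr_curve (i alpha) (i beta) (i c) (map_poly i E).
Proof.
rewrite /sqr_curve rmorphB rmorphXn /= map_polyXsubC /= map_polyC /= map_polyC.
rewrite /= map_comp_poly rmorphM rmorphXn /= map_polyX linearZ /=.
by rewrite map_polyXsubC /= fmorphV.
Qed.

(** * The function field of the square curve *)

Section SqrCurveFunctionField.
Variables (k : fieldType) (alpha beta c : k) (E : {poly k}).
Hypotheses (alpha0 : alpha != 0) (E0 : E != 0).
Local Notation P := (sqr_curve alpha beta c E).
Local Notation x := (alpha *: 'X^2 + beta%:P).
Local Notation y := (c%:P + 'X * (E \Po 'X^2)).
Local Notation T := (('X : {poly k})%:F).

Lemma size_sqrX_affine : size x = 3%N.
Proof. by rewrite size_polyDl size_scale ?size_polyXn // ltnS size_polyC ltnW // ltnS leq_b1. Qed.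

Lemma polynomial_transcendental (p : {poly k}) : (1 < size p)%N ->
  ~ algebraicOver (@ratfunC k) p%:F.
Proof.
move=> sp [q q0 /rootP/eqP]; rewrite map_poly_comp horner_map tofrac_eq0.
by rewrite -[_.[_]]/(q \Po p) comp_poly_eq0 // (negPf q0).
Qed.

(** K is k(X) with a square root r of u = (X - beta)/alpha adjoined; X |-> alpha T^2 + beta, r |-> T
    identifies it with k(T). *)
Lemma quadratic_extension : exists K : fieldExtType (ratfun k),
  [/\ \dim {: K} = 2 & exists s : {rmorphism ratfun k -> K},
    [/\ bijective s, forall a, s (ratfunC a) = constC K a & s x%:F = (T)%:A]].
Proof.
have sx : (1 < size x)%N by rewrite size_sqrX_affine.
have [i [iT iC]] := ratfun_lift (polynomial_transcendental sx).
have iE (p : {poly k}) : i p%:F = (p \Po x)%:F.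
  rewrite (rmorph_tofrac (j := @ratfunC k)) // iT map_poly_comp horner_map //.
pose u : {poly k} := alpha^-1 *: ('X - beta%:P).
have iu : i u%:F = T ^+ 2 by rewrite iE affine_comp_inv // tofracXn.
pose p : {poly ratfun k} := 'X^2 - (u%:F)%:P.
have sp : size p = 3%N by rewrite size_polyDl ?size_polyXn // size_polyN size_polyC; case: (_ == _).
(* u has degree 1, so n^2 = u d^2 is impossible by parity of degrees. *)
have p_irr : irreducible_poly p.
  apply: cubic_irreducible; first by rewrite sp.
  move=> r; apply/negP => /rootP; rewrite hornerD hornerN hornerC hornerXn.
  have [n [d [d0 ->]]] := fracP r => /eqP.
  rewrite subr_eq0 expr_div_n -!tofracXn.
  rewrite -[u%:F]divr1 -tofrac1 eqr_div ?tofrac_eq0 ?expf_neq0 ?oner_eq0 //.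
  rewrite -!tofracM tofrac_eq mulr1 => /eqP e.
  have su : size u = 2%N by rewrite size_scale ?invr_eq0 // size_XsubC.
  have := congr1 (fun q : {poly k} => (size q).-1) e.
  rewrite size_exp size_mul ?expf_neq0 // -?size_poly_gt0 ?su // add2n /=.
  rewrite -(prednK (n := size (d ^+ 2))) ?size_poly_gt0 ?expf_neq0 // size_exp.
  by move/(congr1 odd); rewrite /= !oddM !andbF.
have pT : root (map_poly i p) T.
  apply/rootP; rewrite rmorphB /= map_polyXn map_polyC /= iu.
  by rewrite hornerD hornerN hornerXn hornerC subrr.
have p0 : p != 0 by rewrite -size_poly_gt0 sp.
have [K [inj [r [dimK inj_alg inj_r]]]] : exists (K : fieldExtType (ratfun k))
    (inj : {rmorphism K -> ratfun k}) (r : K),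
    [/\ \dim {: K} = 2, forall w, inj (w%:A) = i w & inj r = T].
  exists (SubFieldExtType pT p_irr), (@subfx_inj _ _ i T p), (subfx_root i T p).
  split; first by rewrite dimvf -[RHS]/(3.-1) -sp.
    by move=> w; apply: subfx_inj_base.
  exact: subfx_inj_root.
have inj_poly (q : {poly k}) : inj (map_poly (@constC k K) q).[r] = q%:F.
  rewrite -horner_map -map_poly_comp tofrac_poly /= inj_r; congr _.[_].
  by apply: eq_map_poly => a /=; rewrite inj_alg iC.
have inj_bij : bijective inj.
  have inj_surj w : exists v, inj v == w.
    have [n [d [_ ->]]] := fracP w.
    exists ((map_poly (@constC k K) n).[r] / (map_poly (@constC k K) d).[r]).
    by rewrite fmorph_div !inj_poly.
  exists (fun w => xchoose (inj_surj w)) => [v|w]; last exact/eqP/(xchooseP (inj_surj w)).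
  by apply: (fmorph_inj inj); apply/eqP/(xchooseP (inj_surj _)).
have [s [injK sK]] := rmorph_inverse inj_bij.
exists K; split=> //; exists s; split; first by exists inj.
  by move=> a; rewrite -iC -inj_alg injK.
by rewrite -iT -inj_alg injK.
Qed.

Lemma sqr_curve_function_field :
  exists (F : function_field P) (s : {rmorphism ratfun k -> ff_field F}),
    parametrization s x y /\ d_X F = 2.
Proof.
have [K [dimK [s [s_bij sC sx]]]] := quadratic_extension.
have evE A : eval_at (s y%:F) A = s (subst x y A)%:F by apply: eval_at_rmorph.
have ker A : eval_at (s y%:F) A = 0 <-> divides P A.
  rewrite -sqr_curve_divides // evE; split=> [/eqP|->]; last by rewrite tofrac0 rmorph0.
  by rewrite fmorph_eq0 tofrac_eq0 => /eqP.
pose ev : {rmorphism {poly {poly k}} -> K} := @eval_at k K (s y%:F).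
have ev_subst A : ev A = s (subst x y A)%:F := evE A.
pose isfrac z := exists A B, ev B != 0 /\ z = ev A / ev B.
have frac z : isfrac z.
  have ev1 : ev 1 != 0 by rewrite rmorph1 oner_neq0.
  have frac_ev A : isfrac (ev A).
    by exists A, 1; split=> //; rewrite rmorph1 divr1.
  have fracD a b : isfrac a -> isfrac b -> isfrac (a + b).
    move=> [A [B [B0 ->]]] [A' [B' [B'0 ->]]].
    exists (A * B' + A' * B), (B * B').
    by rewrite rmorphD !rmorphM mulf_neq0 // addf_div.
  have fracM a b : isfrac a -> isfrac b -> isfrac (a * b).
    move=> [A [B [B0 ->]]] [A' [B' [B'0 ->]]]; exists (A * A'), (B * B').
    by rewrite !rmorphM mulf_neq0 // mulf_div.
  have fracV a : isfrac a -> isfrac a^-1.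
    move=> [A [B [B0 ->]]]; rewrite invf_div; have [A0|A0] := eqVneq (ev A) 0.
      by rewrite A0 invr0 mulr0 -(rmorph0 ev).
    by exists B, A.
  have Tfrac : isfrac (s T).
    pose Eu : {poly k} := E \Po (alpha^-1 *: ('X - beta%:P)).
    have sE : subst x y Eu%:P = E \Po 'X^2 by rewrite substC -comp_polyA affine_comp_inv.
    have E20 : E \Po 'X^2 != 0 by rewrite comp_poly_eq0 // size_polyXn.
    (* On the curve, T = (Y - c) / E((X - beta)/alpha). *)
    exists ('X - c%:P%:P), Eu%:P; rewrite !ev_subst sE; split.
      by rewrite fmorph_eq0 tofrac_eq0.
    rewrite substB substX substC comp_polyC [c%:P + _]addrC addrK.
    by rewrite -fmorph_div tofracM mulfK // tofrac_eq0.
  have Cfrac a : isfrac (s (ratfunC a)).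
    by rewrite sC -[constC K a](eval_atC (s y%:F)); apply: frac_ev.
  have Pfrac (p : {poly k}) : isfrac (s p%:F).
    elim/poly_ind: p => [|p a IH]; first by rewrite tofrac0 rmorph0 -(rmorph0 ev).
    by rewrite tofracD tofracM rmorphD rmorphM; apply: fracD (Cfrac a); apply: fracM.
  have [t sK tK] := s_bij; rewrite -[z]tK; have [n [d [_ ->]]] := fracP (t z).
  by rewrite fmorph_div; apply: fracM => //; apply: fracV.
by exists (FunctionField ker frac), s.
Qed.

End SqrCurveFunctionField.

Lemma decomposition_nongraph_deg2 (k : fieldType) (kbar : closedFieldType)
    (iota : {rmorphism k -> kbar}) (halg : forall z : kbar, algebraicOver iota z)
    (f g : {poly k}) (alpha beta c : k) (E G : {poly k}) :
  square_decomposition f g alpha beta c E G ->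
  exists (P : {poly {poly k}}) (F : function_field P),
    nongraph_deg2_component iota f g F /\
    parametrized_by P (alpha *: 'X^2 + beta%:P) (c%:P + 'X * (E \Po 'X^2)).
Proof.
move=> dec; have [alpha0 E0 _ _ _] := dec.
have [F [s [s_param dimF]]] := sqr_curve_function_field beta c alpha0 E0.
exists (sqr_curve alpha beta c E), F; split; last exact: parametrization_parametrized s_param.
split=> //; last exact: sqr_curve_nongraph.
have [s_bij sC _ _] := s_param; split.
- exact: sqr_curve_component dec.
(* The base change to kbar is again a square curve with nonzero data, hence integral. *)
- rewrite /geometrically_integral map_sqr_curve; apply: sqr_curve_integral.
    by rewrite fmorph_eq0.
  by rewrite map_poly_eq0.
- by exists s.
exact: (polynomial_parametrization_one_point halg s_param).
Qed.
Unset Implicit Arguments.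
Set Strict Implicit.

Theorem theorem8p3 (k : fieldType) (hk : [pchar k] =i pred0)
    (kbar : closedFieldType) (iota : {rmorphism k -> kbar})
    (halg : forall z : kbar, algebraicOver iota z)
    (f g : {poly k}) (hf : (1 < size f)%N) (hg : (1 < size g)%N) :
  [/\
      has_nongraph_deg2_component iota f g <->
      (exists (alpha beta c : k) (E G : {poly k}),
         square_decomposition f g alpha beta c E G),
      (forall (alpha beta c : k) (E G : {poly k}),
         square_decomposition f g alpha beta c E G ->
         exists (P : {poly {poly k}}) (F : function_field P),
           nongraph_deg2_component iota f g F /\
           parametrized_by P (alpha *: 'X^2 + beta%:P)
                             (c%:P + 'X * (E \Po 'X^2))) /\
      (forall (P : {poly {poly k}}) (F : function_field P),
         nongraph_deg2_component iota f g F ->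
         exists (alpha beta c : k) (E G : {poly k}),
           square_decomposition f g alpha beta c E G /\
           parametrized_by P (alpha *: 'X^2 + beta%:P)
                             (c%:P + 'X * (E \Po 'X^2))),
      (~ exists c : k, g \Po ((c *+ 2)%:P - 'X) = g) ->
      ~ has_nongraph_deg2_component iota f g
    & odd (size g).-1 -> ~ has_nongraph_deg2_component iota f g].
Proof.
have to_dec (P : {poly {poly k}}) (F : function_field P)
    (hF : nongraph_deg2_component iota f g F) :=
  nongraph_deg2_decomposition hk halg hg hF.
have has_dec : has_nongraph_deg2_component iota f g ->
    exists (alpha beta c : k) (E G : {poly k}), square_decomposition f g alpha beta c E G.
  by move=> [P [F /to_dec[alpha [beta [c [E [G [dec _]]]]]]]]; exists alpha, beta, c, E, G.
split.
- split=> // -[alpha [beta [c [E [G dec]]]]].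
  by have [P [F [hF _]]] := decomposition_nongraph_deg2 halg dec; exists P, F.
- split=> [alpha beta c E G|]; [exact: decomposition_nongraph_deg2 | exact: to_dec].
(* The reflection Y |-> 2c - Y preserves (Y - c)^2, hence g. *)
- move=> no_inv /has_dec[alpha [beta [c [E [G [_ _ _ eg _]]]]]]; apply: no_inv; exists c.
  rewrite {1}eg -comp_polyA rmorphXn /= comp_polyB comp_polyX comp_polyC.
  rewrite [in RHS]eg; congr (_ \Po _).
  by rewrite polyCMn; ring.
move=> g_odd /has_dec[alpha [beta [c [E [G [_ _ _ eg _]]]]]].
(* deg g = 2 deg G is even. *)
by move: g_odd; rewrite eg size_comp_poly size_exp_XsubC oddM andbF.
Qed.
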